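(* Let $Q$ be a Dynkin quiver and let $X,M,N\in\mathcal{D}^b(Q)$ with $\mathbf{dim}\,M=\mathbf{dim}\,N$. Then $$\langle X,N\rangle-\langle X,M\rangle=\langle N,\tau X\rangle-\langle M,\tau X\rangle.$$
   Context: $\Bbbk$ is an algebraically closed field; $Q$ is a quiver whose underlying graph is Dynkin of type $\mathbb{A}$, $\mathbb{D}$ or $\mathbb{E}$; $\mathcal{D}^b(Q)$ is the bounded derived category of the category of finite dimensional representations of $Q$ over $\Bbbk$, with shift $[1]$. $\mathbf{dim}\,X\in\mathbb{Z}^{Q_0}\cong K_0(\mathcal{D}^b(Q))$ is the class of $X$ in the Grothendieck group (extending the dimension vector). $[X,Y]^i=\dim_\Bbbk\mathrm{Hom}_{\mathcal{D}^b(Q)}(X,Y[i])$ and $\langle X,Y\rangle=\sum_{i\le0}(-1)^i[X,Y]^i$. $\nu$ is the Serre functor of $\mathcal{D}^b(Q)$, i.e. an auto-equivalence with natural isomorphisms $\mathrm{Hom}(Y,\nu X)\simeq\mathrm{Hom}_\Bbbk(\mathrm{Hom}(X,Y),\Bbbk)$, and $\tau=\nu\circ[-1]$ is the Auslander–Reiten translation. *)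

(* Defs.v *)
From HB Require Import structures.
From mathcomp Require Import all_boot all_order all_algebra generic_quotient.
From mathcomp Require Import boolp classical_sets functions cardinality fsbigop.

Set Implicit Arguments.
Unset Strict Implicit.
Unset Printing Implicit Defensive.

Import Order.TTheory GRing.Theory Num.Theory.
Local Open Scope classical_set_scope.
Local Open Scope ring_scope.
Local Open Scope quotient_scope.

(* Composition is written in diagrammatic order: [comp f g] is "f, then g",
   i.e. the usual g o f. *)
Record lincat (k : fieldType) := LinCat {
  obj :> Type;
  hom : obj -> obj -> lmodType k;
  idm : forall X, hom X X;
  comp : forall X Y Z, hom X Y -> hom Y Z -> hom X Z;
  comp1m : forall X Y (f : hom X Y), comp (idm X) f = f;
  compm1 : forall X Y (f : hom X Y), comp f (idm Y) = f;
  compA : forall X Y Z T (f : hom X Y) (g : hom Y Z) (h : hom Z T),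
    comp f (comp g h) = comp (comp f g) h;
  compDl : forall X Y Z (c : k) (f f' : hom X Y) (g : hom Y Z),
    comp (c *: f + f') g = c *: comp f g + comp f' g;
  compDr : forall X Y Z (c : k) (f : hom X Y) (g g' : hom Y Z),
    comp f (c *: g + g') = c *: comp f g + comp f g' }.

Arguments hom {k l} X Y.
Arguments idm {k l} X.
Arguments comp {k l X Y Z} f g.

Notation "f >>> g" := (comp f g) (at level 40, left associativity).

Definition is_iso (k : fieldType) (C : lincat k) (X Y : C) (f : hom X Y) : Prop :=
  exists g : hom Y X, f >>> g = idm X /\ g >>> f = idm Y.

Record functor (k : fieldType) (C D : lincat k) := Functor {
  fobj :> C -> D;
  fmor : forall X Y, hom X Y -> hom (fobj X) (fobj Y);
  fmor_linear : forall X Y (c : k) (f g : hom X Y),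
    fmor (c *: f + g) = c *: fmor f + fmor g;
  fmor_id : forall X, fmor (idm X) = idm (fobj X);
  fmor_comp : forall X Y Z (f : hom X Y) (g : hom Y Z),
    fmor (f >>> g) = fmor f >>> fmor g }.

Arguments fmor {k C D} _ {X Y} f.

Definition naturally_iso_id (k : fieldType) (C D : lincat k)
    (F : functor C D) (G : functor D C) : Prop :=
  exists2 eta : forall X : C, hom (G (F X)) X,
    forall X, is_iso (eta X) &
    forall (X Y : C) (f : hom X Y), fmor G (fmor F f) >>> eta Y = eta X >>> f.

Definition is_equivalence (k : fieldType) (C D : lincat k) (F : functor C D) : Prop :=
  exists G : functor D C, naturally_iso_id F G /\ naturally_iso_id G F.

(* [eta X Y] is the isomorphism Hom(Y, nu X) -> Hom_k(Hom(X, Y), k), written as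
   a function of two arguments. *)
Record is_serre_functor (k : fieldType) (C : lincat k) (nu : functor C C) : Prop :=
  IsSerreFunctor {
  serre_equivalence : is_equivalence nu;
  serre_duality :
    exists eta : forall X Y : C, hom Y (nu X) -> hom X Y -> k,
    [/\ forall (X Y : C) (phi : hom Y (nu X)) (c : k) (g g' : hom X Y),
          eta X Y phi (c *: g + g') = c * eta X Y phi g + eta X Y phi g',
        forall (X Y : C) (c : k) (phi phi' : hom Y (nu X)) (g : hom X Y),
          eta X Y (c *: phi + phi') g = c * eta X Y phi g + eta X Y phi' g,
        forall (X Y : C) (l : {scalar hom X Y}),
          exists! phi : hom Y (nu X), eta X Y phi =1 l,
        forall (X Y Y' : C) (h : hom Y Y') (phi : hom Y' (nu X)) (g : hom X Y),
          eta X Y (h >>> phi) g = eta X Y' phi (g >>> h) &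
        forall (X X' Y : C) (a : hom X X') (phi : hom Y (nu X)) (g : hom X' Y),
          eta X' Y (phi >>> fmor nu a) g = eta X Y phi (a >>> g)] }.

(* The dimension of a vector space; 0 if the space has infinite dimension. *)
Definition dimk (k : fieldType) (V : lmodType k) : nat :=
  xget 0%N [set n | inhabited (Vector.axiom n V)].

(* The universal k-linear category with a k-linear functor from [C] making the
   morphisms in [W] invertible: same objects as [C]; morphisms are k-linear
   combinations of composites of morphisms of [C] and formal inverses of
   elements of [W], modulo the congruence generated by the axioms of a k-linear
   category, by the k-linear functoriality of [LMor], and by the requirement
   that [LInv s] is inverse to [LMor s]. *)
Section Localization.
Variables (k : fieldType) (C : lincat k).
Variable W : forall X Y : C, hom X Y -> Prop.

Inductive loc_term : C -> C -> Type :=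
| LMor X Y (f : hom X Y) : loc_term X Y
| LInv X Y (s : hom X Y) (Ws : W s) : loc_term Y X
| LComp X Y Z (f : loc_term X Y) (g : loc_term Y Z) : loc_term X Z
| LAdd X Y (f g : loc_term X Y) : loc_term X Y
| LScale X Y (c : k) (f : loc_term X Y) : loc_term X Y.

Inductive loc_eq : forall X Y, loc_term X Y -> loc_term X Y -> Prop :=
| loc_refl X Y (f : loc_term X Y) : loc_eq f f
| loc_sym X Y (f g : loc_term X Y) : loc_eq f g -> loc_eq g f
| loc_trans X Y (f g h : loc_term X Y) : loc_eq f g -> loc_eq g h -> loc_eq f h
| loc_congComp X Y Z (f f' : loc_term X Y) (g g' : loc_term Y Z) :
    loc_eq f f' -> loc_eq g g' -> loc_eq (LComp f g) (LComp f' g')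
| loc_congAdd X Y (f f' g g' : loc_term X Y) :
    loc_eq f f' -> loc_eq g g' -> loc_eq (LAdd f g) (LAdd f' g')
| loc_congScale X Y (c : k) (f f' : loc_term X Y) :
    loc_eq f f' -> loc_eq (LScale c f) (LScale c f')
| loc_addA X Y (f g h : loc_term X Y) :
    loc_eq (LAdd f (LAdd g h)) (LAdd (LAdd f g) h)
| loc_addC X Y (f g : loc_term X Y) : loc_eq (LAdd f g) (LAdd g f)
| loc_add0 X Y (f : loc_term X Y) : loc_eq (LAdd (LMor 0) f) f
| loc_addN X Y (f : loc_term X Y) : loc_eq (LAdd (LScale (-1) f) f) (LMor 0)
| loc_scaleA X Y (a b : k) (f : loc_term X Y) :
    loc_eq (LScale a (LScale b f)) (LScale (a * b) f)
| loc_scale1 X Y (f : loc_term X Y) : loc_eq (LScale 1 f) f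
| loc_scaleDr X Y (a : k) (f g : loc_term X Y) :
    loc_eq (LScale a (LAdd f g)) (LAdd (LScale a f) (LScale a g))
| loc_scaleDl X Y (a b : k) (f : loc_term X Y) :
    loc_eq (LScale (a + b) f) (LAdd (LScale a f) (LScale b f))
| loc_comp1m X Y (f : loc_term X Y) : loc_eq (LComp (LMor (idm X)) f) f
| loc_compm1 X Y (f : loc_term X Y) : loc_eq (LComp f (LMor (idm Y))) f
| loc_compA X Y Z T (f : loc_term X Y) (g : loc_term Y Z) (h : loc_term Z T) :
    loc_eq (LComp f (LComp g h)) (LComp (LComp f g) h)
| loc_compDl X Y Z (c : k) (f f' : loc_term X Y) (g : loc_term Y Z) :
    loc_eq (LComp (LAdd (LScale c f) f') g)
           (LAdd (LScale c (LComp f g)) (LComp f' g))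
| loc_compDr X Y Z (c : k) (f : loc_term X Y) (g g' : loc_term Y Z) :
    loc_eq (LComp f (LAdd (LScale c g) g'))
           (LAdd (LScale c (LComp f g)) (LComp f g'))
| loc_morD X Y (c : k) (f g : hom X Y) :
    loc_eq (LMor (c *: f + g)) (LAdd (LScale c (LMor f)) (LMor g))
| loc_morComp X Y Z (f : hom X Y) (g : hom Y Z) :
    loc_eq (LMor (f >>> g)) (LComp (LMor f) (LMor g))
| loc_invr X Y (s : hom X Y) (Ws : W s) :
    loc_eq (LComp (LMor s) (LInv Ws)) (LMor (idm X))
| loc_invl X Y (s : hom X Y) (Ws : W s) :
    loc_eq (LComp (LInv Ws) (LMor s)) (LMor (idm Y)).

HB.instance Definition _ X Y := gen_eqMixin (loc_term X Y).
HB.instance Definition _ X Y := gen_choiceMixin (loc_term X Y).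

Section LocHom.
Variables X Y : C.

Definition loc_eqb (f g : loc_term X Y) : bool := `[< loc_eq f g >].

Lemma loc_eqb_equiv : equiv_class_of loc_eqb.
Proof.
split=> [f|f g|g f h].
- exact/asboolP/loc_refl.
- by apply/asboolP/asboolP; apply: loc_sym.
- by move=> /asboolP fg /asboolP gh; apply/asboolP; apply: loc_trans fg gh.
Qed.

Canonical loc_equiv := EquivRelPack loc_eqb_equiv.

Definition loc_hom := {eq_quot loc_equiv}.

HB.instance Definition _ := Choice.on loc_hom.
HB.instance Definition _ := EqQuotient.on loc_hom.

Definition loc_pi (f : loc_term X Y) : loc_hom := \pi_loc_hom f.

Lemma loc_piP (f g : loc_term X Y) : loc_pi f = loc_pi g <-> loc_eq f g.
Proof.
split; first by move=> /eqmodP /asboolP.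
by move=> fg; apply/eqmodP/asboolP.
Qed.

Lemma loc_reprK (f : loc_hom) : loc_pi (repr f) = f.
Proof. exact: reprK. Qed.

Lemma loc_repr_pi (f : loc_term X Y) : loc_eq (repr (loc_pi f)) f.
Proof. by apply/loc_piP; rewrite loc_reprK. Qed.

Definition loc_zero : loc_hom := loc_pi (LMor 0).
Definition loc_add (f g : loc_hom) : loc_hom := loc_pi (LAdd (repr f) (repr g)).
Definition loc_scale (c : k) (f : loc_hom) : loc_hom := loc_pi (LScale c (repr f)).
Definition loc_opp (f : loc_hom) : loc_hom := loc_scale (-1) f.

Lemma loc_piD f g : loc_add (loc_pi f) (loc_pi g) = loc_pi (LAdd f g).
Proof. by apply/loc_piP/loc_congAdd; apply: loc_repr_pi. Qed.

Lemma loc_piZ c f : loc_scale c (loc_pi f) = loc_pi (LScale c f).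
Proof. by apply/loc_piP/loc_congScale; apply: loc_repr_pi. Qed.

Lemma loc_addrA : associative loc_add.
Proof.
move=> f g h; rewrite -(loc_reprK f) -(loc_reprK g) -(loc_reprK h) !loc_piD.
exact/loc_piP/loc_addA.
Qed.

Lemma loc_addrC : commutative loc_add.
Proof.
move=> f g; rewrite -(loc_reprK f) -(loc_reprK g) !loc_piD.
exact/loc_piP/loc_addC.
Qed.

Lemma loc_add0r : left_id loc_zero loc_add.
Proof. by move=> f; rewrite -(loc_reprK f) loc_piD; apply/loc_piP/loc_add0. Qed.

Lemma loc_addNr : left_inverse loc_zero loc_opp loc_add.
Proof.
by move=> f; rewrite -(loc_reprK f) /loc_opp loc_piZ loc_piD; apply/loc_piP/loc_addN.
Qed.

HB.instance Definition _ :=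
  GRing.isZmodule.Build loc_hom loc_addrA loc_addrC loc_add0r loc_addNr.

Lemma loc_scalerA a b f : loc_scale a (loc_scale b f) = loc_scale (a * b) f.
Proof. by rewrite -(loc_reprK f) !loc_piZ; apply/loc_piP/loc_scaleA. Qed.

Lemma loc_scale1r : left_id 1 loc_scale.
Proof. by move=> f; rewrite -(loc_reprK f) loc_piZ; apply/loc_piP/loc_scale1. Qed.

Lemma loc_scalerDr : right_distributive loc_scale +%R.
Proof.
move=> a f g; rewrite -(loc_reprK f) -(loc_reprK g).
by rewrite /GRing.add /= !(loc_piD, loc_piZ); apply/loc_piP/loc_scaleDr.
Qed.

Lemma loc_scalerDl f : {morph loc_scale^~ f : a b / a + b}.
Proof.
move=> a b; rewrite -(loc_reprK f).
rewrite [in RHS]/GRing.add /= !loc_piZ loc_piD.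
exact/loc_piP/loc_scaleDl.
Qed.

HB.instance Definition _ := GRing.Zmodule_isLmodule.Build k loc_hom
  loc_scalerA loc_scale1r loc_scalerDr loc_scalerDl.

End LocHom.

Definition loc_comp X Y Z (f : loc_hom X Y) (g : loc_hom Y Z) : loc_hom X Z :=
  loc_pi (LComp (repr f) (repr g)).

Lemma loc_piM X Y Z (f : loc_term X Y) (g : loc_term Y Z) :
  loc_comp (loc_pi f) (loc_pi g) = loc_pi (LComp f g).
Proof. by apply/loc_piP/loc_congComp; apply: loc_repr_pi. Qed.

Lemma loc_homDE X Y (c : k) (f g : loc_term X Y) :
  c *: loc_pi f + loc_pi g = loc_pi (LAdd (LScale c f) g).
Proof. by rewrite -loc_piD -loc_piZ. Qed.

Lemma loc_hom1m X Y (f : loc_hom X Y) : loc_comp (loc_pi (LMor (idm X))) f = f.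
Proof. by rewrite -(loc_reprK f) loc_piM; apply/loc_piP/loc_comp1m. Qed.

Lemma loc_homm1 X Y (f : loc_hom X Y) : loc_comp f (loc_pi (LMor (idm Y))) = f.
Proof. by rewrite -(loc_reprK f) loc_piM; apply/loc_piP/loc_compm1. Qed.

Lemma loc_homA X Y Z T (f : loc_hom X Y) (g : loc_hom Y Z) (h : loc_hom Z T) :
  loc_comp f (loc_comp g h) = loc_comp (loc_comp f g) h.
Proof.
rewrite -(loc_reprK f) -(loc_reprK g) -(loc_reprK h) !loc_piM.
exact/loc_piP/loc_compA.
Qed.

Lemma loc_homDl X Y Z (c : k) (f f' : loc_hom X Y) (g : loc_hom Y Z) :
  loc_comp (c *: f + f') g = c *: loc_comp f g + loc_comp f' g.
Proof.
rewrite -(loc_reprK f) -(loc_reprK f') -(loc_reprK g).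
by rewrite !(loc_homDE, loc_piM); apply/loc_piP/loc_compDl.
Qed.

Lemma loc_homDr X Y Z (c : k) (f : loc_hom X Y) (g g' : loc_hom Y Z) :
  loc_comp f (c *: g + g') = c *: loc_comp f g + loc_comp f g'.
Proof.
rewrite -(loc_reprK f) -(loc_reprK g) -(loc_reprK g').
by rewrite !(loc_homDE, loc_piM); apply/loc_piP/loc_compDr.
Qed.

Definition localization : lincat k :=
  @LinCat k C (fun X Y => loc_hom X Y : lmodType k)
    (fun X => loc_pi (LMor (idm X))) loc_comp
    loc_hom1m loc_homm1 loc_homA loc_homDl loc_homDr.

End Localization.

Section Complexes.
Variables (k : fieldType) (C : lincat k).

(* The differential is a matrix of morphisms [cdiff i j], zero unless
   j = i + 1; this keeps the shift functors free of casts between degrees. *)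
Record complex := Complex {
  cobj :> int -> C;
  cdiff : forall i j, hom (cobj i) (cobj j);
  cdiff_deg : forall i j, j != i + 1 -> cdiff i j = 0;
  cdiff_sq : forall i j l, cdiff i j >>> cdiff j l = 0;
  cbounded : exists b : nat, forall i : int,
    (b < `|i|)%N -> idm (cobj i) = 0 }.

Lemma comp0m X Y Z (g : @hom k C Y Z) : (0 : hom X Y) >>> g = 0.
Proof.
have /eqP := compDl 1 (0 : hom X Y) 0 g.
by rewrite scaler0 addr0 scale1r addrC -subr_eq subrr eq_sym => /eqP.
Qed.

Lemma compm0 X Y Z (f : @hom k C X Y) : f >>> (0 : hom Y Z) = 0.
Proof.
have /eqP := compDr 1 f (0 : hom Y Z) 0.
by rewrite scaler0 addr0 scale1r addrC -subr_eq subrr eq_sym => /eqP.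
Qed.

Lemma compZl X Y Z (c : k) (f : @hom k C X Y) (g : hom Y Z) :
  (c *: f) >>> g = c *: (f >>> g).
Proof. by have := compDl c f 0 g; rewrite comp0m !addr0. Qed.

Lemma compZr X Y Z (c : k) (f : @hom k C X Y) (g : hom Y Z) :
  f >>> (c *: g) = c *: (f >>> g).
Proof. by have := compDr c f g 0; rewrite compm0 !addr0. Qed.

Section Shift.
Variables (X : complex) (n : int).

Definition shift_diff (i j : int) : hom (X (i + n)) (X (j + n)) :=
  ((-1) ^ n : k) *: cdiff X (i + n) (j + n).

Lemma shift_diff_deg i j : j != i + 1 -> shift_diff i j = 0.
Proof.
move=> ij; rewrite /shift_diff cdiff_deg ?scaler0 //.
by rewrite addrAC (inj_eq (addIr n)).
Qed.

Lemma shift_diff_sq i j l : shift_diff i j >>> shift_diff j l = 0.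
Proof. by rewrite /shift_diff compZl compZr cdiff_sq !scaler0. Qed.

Lemma shift_bounded : exists b : nat, forall i : int,
  (b < `|i|)%N -> idm (X (i + n)) = 0.
Proof.
have [b bP] := cbounded X; exists (b + `|n|)%N => i bi; apply: bP.
rewrite -(ltn_add2r `|n|%N); apply: leq_trans bi _.
rewrite -{1}[i](addrK n) -lez_nat PoszD !abszE.
by rewrite (le_trans (ler_normB _ _)).
Qed.

Definition shift : complex := Complex shift_diff_deg shift_diff_sq shift_bounded.
End Shift.

Record chain_map (X Y : complex) := ChainMap {
  cmap :> forall i, hom (X i) (Y i);
  cmapP : forall i j, cmap i >>> cdiff Y i j = cdiff X i j >>> cmap j }.

Section ChainHom.
Variables X Y : complex.

Lemma chain_map_eq (f g : chain_map X Y) : (forall i, f i = g i) -> f = g.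
Proof.
case: f g => [f fP] [g gP] /= fg.
have {}fg : f = g by apply: functional_extensionality_dep.
by case: _ / fg gP => gP; congr ChainMap; apply: Prop_irrelevance.
Qed.

HB.instance Definition _ := gen_eqMixin (chain_map X Y).
HB.instance Definition _ := gen_choiceMixin (chain_map X Y).

Lemma chain_lin_subproof (c : k) (f g : chain_map X Y) i j :
  (c *: f i + g i) >>> cdiff Y i j = cdiff X i j >>> (c *: f j + g j).
Proof. by rewrite compDl compDr !cmapP. Qed.

Lemma chain_zero_subproof i j :
  (0 : hom (X i) (Y i)) >>> cdiff Y i j = cdiff X i j >>> 0.
Proof. by rewrite comp0m compm0. Qed.

Definition chain_zero := ChainMap chain_zero_subproof.
Definition chain_lin c f g := ChainMap (chain_lin_subproof c f g).
Definition chain_add f g := chain_lin 1 f g.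
Definition chain_scale c f := chain_lin c f chain_zero.
Definition chain_opp f := chain_scale (-1) f.

Lemma chain_addrA : associative chain_add.
Proof. by move=> f g h; apply: chain_map_eq => i; rewrite /= !scale1r addrA. Qed.

Lemma chain_addrC : commutative chain_add.
Proof. by move=> f g; apply: chain_map_eq => i; rewrite /= !scale1r addrC. Qed.

Lemma chain_add0r : left_id chain_zero chain_add.
Proof. by move=> f; apply: chain_map_eq => i; rewrite /= scaler0 add0r. Qed.

Lemma chain_addNr : left_inverse chain_zero chain_opp chain_add.
Proof.
by move=> f; apply: chain_map_eq => i; rewrite /= addr0 scale1r scaleN1r addNr.
Qed.

HB.instance Definition _ := GRing.isZmodule.Build (chain_map X Y)
  chain_addrA chain_addrC chain_add0r chain_addNr.

Lemma chain_addE (f g : chain_map X Y) i : (f + g) i = f i + g i.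
Proof. by rewrite {1}/GRing.add /= scale1r. Qed.

Lemma chain_scaleE c f i : chain_scale c f i = c *: f i.
Proof. exact: addr0. Qed.

Lemma chain_scalerA a b f : chain_scale a (chain_scale b f) = chain_scale (a * b) f.
Proof. by apply: chain_map_eq => i; rewrite /= !addr0 scalerA. Qed.

Lemma chain_scale1r : left_id 1 chain_scale.
Proof. by move=> f; apply: chain_map_eq => i; rewrite /= addr0 scale1r. Qed.

Lemma chain_scalerDr : right_distributive chain_scale +%R.
Proof.
by move=> a f g; apply: chain_map_eq => i; rewrite chain_addE !chain_scaleE chain_addE scalerDr.
Qed.

Lemma chain_scalerDl f : {morph chain_scale^~ f : a b / a + b}.
Proof.
by move=> a b; apply: chain_map_eq => i; rewrite chain_addE !chain_scaleE scalerDl.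
Qed.

HB.instance Definition _ := GRing.Zmodule_isLmodule.Build k (chain_map X Y)
  chain_scalerA chain_scale1r chain_scalerDr chain_scalerDl.

Lemma chain_linE (c : k) (f g : chain_map X Y) i : (c *: f + g) i = c *: f i + g i.
Proof. by rewrite chain_addE {1}/GRing.scale /= addr0. Qed.

End ChainHom.

Lemma chain_id_subproof (X : complex) i j :
  idm (X i) >>> cdiff X i j = cdiff X i j >>> idm (X j).
Proof. by rewrite comp1m compm1. Qed.

Definition chain_id X : chain_map X X := ChainMap (@chain_id_subproof X).

Lemma chain_comp_subproof X Y Z (f : chain_map X Y) (g : chain_map Y Z) i j :
  (f i >>> g i) >>> cdiff Z i j = cdiff X i j >>> (f j >>> g j).
Proof. by rewrite -compA cmapP compA cmapP compA. Qed.

Definition chain_comp X Y Z (f : chain_map X Y) (g : chain_map Y Z) : chain_map X Z :=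
  ChainMap (chain_comp_subproof f g).

Lemma chain_compE X Y Z (f : chain_map X Y) (g : chain_map Y Z) i :
  chain_comp f g i = f i >>> g i.
Proof. by []. Qed.

Lemma chain_comp1m X Y (f : chain_map X Y) : chain_comp (chain_id X) f = f.
Proof. by apply: chain_map_eq => i; apply: comp1m. Qed.

Lemma chain_compm1 X Y (f : chain_map X Y) : chain_comp f (chain_id Y) = f.
Proof. by apply: chain_map_eq => i; apply: compm1. Qed.

Lemma chain_compA X Y Z T (f : chain_map X Y) (g : chain_map Y Z) (h : chain_map Z T) :
  chain_comp f (chain_comp g h) = chain_comp (chain_comp f g) h.
Proof. by apply: chain_map_eq => i; apply: compA. Qed.

Lemma chain_compDl X Y Z (c : k) (f f' : chain_map X Y) (g : chain_map Y Z) :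
  chain_comp (c *: f + f') g = c *: chain_comp f g + chain_comp f' g.
Proof. by apply: chain_map_eq => i; rewrite chain_linE !chain_compE chain_linE compDl. Qed.

Lemma chain_compDr X Y Z (c : k) (f : chain_map X Y) (g g' : chain_map Y Z) :
  chain_comp f (c *: g + g') = c *: chain_comp f g + chain_comp f g'.
Proof. by apply: chain_map_eq => i; rewrite chain_linE !chain_compE chain_linE compDr. Qed.

Definition complexes : lincat k :=
  @LinCat k complex (fun X Y => chain_map X Y : lmodType k) chain_id chain_comp
    chain_comp1m chain_compm1 chain_compA chain_compDl chain_compDr.

End Complexes.

Record quiver := Quiver {
  vertex : finType;
  arrow : finType;
  source : arrow -> vertex;
  target : arrow -> vertex }.

(* Dynkin diagrams on the vertices 0, ..., n - 1.  In types D and E the vertices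
   0, ..., n - 2 form a chain and n - 1 is attached to the vertex n - 3
   (type D) or 2 (type E). *)
Inductive dynkin_type := TypeA | TypeD | TypeE.

Definition dynkin_rank_ok (t : dynkin_type) (n : nat) : bool :=
  match t with
  | TypeA => (1 <= n)%N
  | TypeD => (4 <= n)%N
  | TypeE => (6 <= n <= 8)%N
  end.

Definition dynkin_edge (t : dynkin_type) (n i j : nat) : bool :=
  match t with
  | TypeA => j == i.+1
  | TypeD => ((j == i.+1) && (j < n.-1)) || ((i == n - 3) && (j == n.-1))
  | TypeE => ((j == i.+1) && (j < n.-1)) || ((i == 2) && (j == n.-1))
  end%N.

Definition is_dynkin (Q : quiver) : Prop :=
  exists (t : dynkin_type) (n : nat) (phi : vertex Q -> 'I_n),
  [/\ dynkin_rank_ok t n, bijective phi &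
      forall x y : vertex Q,
        #|[pred a : arrow Q | ((source a == x) && (target a == y))
                          || ((source a == y) && (target a == x))]|
        = (dynkin_edge t n (phi x) (phi y) || dynkin_edge t n (phi y) (phi x)) :> nat].

Section Representations.
Variables (k : fieldType) (Q : quiver).

(* The space at v is k^(rdim v), of row vectors; matrices act on the right. *)
Record rep := Rep {
  rdim : vertex Q -> nat;
  rmap : forall a : arrow Q, 'M[k]_(rdim (source a), rdim (target a)) }.

Record rep_hom (V U : rep) := RepHom {
  rhom :> forall v, 'M[k]_(rdim V v, rdim U v);
  rhomP : forall a : arrow Q, rhom (source a) *m rmap U a = rmap V a *m rhom (target a) }.

Section RepHom.
Variables V U : rep.

Lemma rep_hom_eq (f g : rep_hom V U) : (forall v, f v = g v) -> f = g.
Proof.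
case: f g => [f fP] [g gP] /= fg.
have {}fg : f = g by apply: functional_extensionality_dep.
by case: _ / fg gP => gP; congr RepHom; apply: Prop_irrelevance.
Qed.

HB.instance Definition _ := gen_eqMixin (rep_hom V U).
HB.instance Definition _ := gen_choiceMixin (rep_hom V U).

Lemma rep_lin_subproof (c : k) (f g : rep_hom V U) (a : arrow Q) :
  (c *: f (source a) + g (source a)) *m rmap U a
  = rmap V a *m (c *: f (target a) + g (target a)).
Proof. by rewrite mulmxDl mulmxDr -scalemxAl -scalemxAr !rhomP. Qed.

Lemma rep_zero_subproof (a : arrow Q) :
  (0 : 'M[k]_(rdim V (source a), rdim U (source a))) *m rmap U a = rmap V a *m 0.
Proof. by rewrite mul0mx mulmx0. Qed.

Definition rep_zero := @RepHom V U (fun v => 0) rep_zero_subproof.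
Definition rep_lin (c : k) (f g : rep_hom V U) :=
  @RepHom V U (fun v => c *: f v + g v) (rep_lin_subproof c f g).
Definition rep_add f g := rep_lin 1 f g.
Definition rep_scale c f := rep_lin c f rep_zero.
Definition rep_opp f := rep_scale (-1) f.

Lemma rep_addrA : associative rep_add.
Proof. by move=> f g h; apply: rep_hom_eq => v; rewrite /= !scale1r addrA. Qed.

Lemma rep_addrC : commutative rep_add.
Proof. by move=> f g; apply: rep_hom_eq => v; rewrite /= !scale1r addrC. Qed.

Lemma rep_add0r : left_id rep_zero rep_add.
Proof. by move=> f; apply: rep_hom_eq => v; rewrite /= scaler0 add0r. Qed.

Lemma rep_addNr : left_inverse rep_zero rep_opp rep_add.
Proof.
by move=> f; apply: rep_hom_eq => v; rewrite /= addr0 scale1r scaleN1r addNr.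
Qed.

HB.instance Definition _ := GRing.isZmodule.Build (rep_hom V U)
  rep_addrA rep_addrC rep_add0r rep_addNr.

Lemma rep_addE (f g : rep_hom V U) v : (f + g) v = f v + g v.
Proof. by rewrite {1}/GRing.add /= scale1r. Qed.

Lemma rep_scaleE c f v : rep_scale c f v = c *: f v.
Proof. exact: addr0. Qed.

Lemma rep_scalerA a b f : rep_scale a (rep_scale b f) = rep_scale (a * b) f.
Proof. by apply: rep_hom_eq => v; rewrite /= !addr0 scalerA. Qed.

Lemma rep_scale1r : left_id 1 rep_scale.
Proof. by move=> f; apply: rep_hom_eq => v; rewrite /= addr0 scale1r. Qed.

Lemma rep_scalerDr : right_distributive rep_scale +%R.
Proof.
by move=> a f g; apply: rep_hom_eq => v; rewrite rep_addE !rep_scaleE rep_addE scalerDr.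
Qed.

Lemma rep_scalerDl f : {morph rep_scale^~ f : a b / a + b}.
Proof.
by move=> a b; apply: rep_hom_eq => v; rewrite rep_addE !rep_scaleE scalerDl.
Qed.

HB.instance Definition _ := GRing.Zmodule_isLmodule.Build k (rep_hom V U)
  rep_scalerA rep_scale1r rep_scalerDr rep_scalerDl.

Lemma rep_linE (c : k) (f g : rep_hom V U) v : (c *: f + g) v = c *: f v + g v.
Proof. by rewrite rep_addE {1}/GRing.scale /= addr0. Qed.

End RepHom.

Lemma rep_id_subproof (V : rep) (a : arrow Q) :
  1%:M *m rmap V a = rmap V a *m 1%:M.
Proof. by rewrite mul1mx mulmx1. Qed.

Definition rep_id V : rep_hom V V :=
  @RepHom V V (fun v => 1%:M) (@rep_id_subproof V).

Lemma rep_comp_subproof U V W (f : rep_hom U V) (g : rep_hom V W) (a : arrow Q) :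
  (f (source a) *m g (source a)) *m rmap W a
  = rmap U a *m (f (target a) *m g (target a)).
Proof. by rewrite -mulmxA rhomP mulmxA rhomP mulmxA. Qed.

Definition rep_comp U V W (f : rep_hom U V) (g : rep_hom V W) : rep_hom U W :=
  @RepHom U W (fun v => f v *m g v) (rep_comp_subproof f g).

Lemma rep_compE U V W (f : rep_hom U V) (g : rep_hom V W) v :
  rep_comp f g v = f v *m g v.
Proof. by []. Qed.

Lemma rep_comp1m U V (f : rep_hom U V) : rep_comp (rep_id U) f = f.
Proof. by apply: rep_hom_eq => v; apply: mul1mx. Qed.

Lemma rep_compm1 U V (f : rep_hom U V) : rep_comp f (rep_id V) = f.
Proof. by apply: rep_hom_eq => v; apply: mulmx1. Qed.

Lemma rep_compA U V W T (f : rep_hom U V) (g : rep_hom V W) (h : rep_hom W T) :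
  rep_comp f (rep_comp g h) = rep_comp (rep_comp f g) h.
Proof. by apply: rep_hom_eq => v; apply: mulmxA. Qed.

Lemma rep_compDl U V W (c : k) (f f' : rep_hom U V) (g : rep_hom V W) :
  rep_comp (c *: f + f') g = c *: rep_comp f g + rep_comp f' g.
Proof.
by apply: rep_hom_eq => v; rewrite rep_linE !rep_compE rep_linE mulmxDl scalemxAl.
Qed.

Lemma rep_compDr U V W (c : k) (f : rep_hom U V) (g g' : rep_hom V W) :
  rep_comp f (c *: g + g') = c *: rep_comp f g + rep_comp f g'.
Proof.
by apply: rep_hom_eq => v; rewrite rep_linE !rep_compE rep_linE mulmxDr scalemxAr.
Qed.

Definition reps : lincat k :=
  @LinCat k rep (fun V U => rep_hom V U : lmodType k) rep_id rep_comp
    rep_comp1m rep_compm1 rep_compA rep_compDl rep_compDr.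

(* H^i(f) : H^i(X) -> H^i(Y) is bijective for every i; kernels and images of
   morphisms of representations are computed vertex by vertex. *)
Definition quasi_iso (X Y : complexes reps) (f : hom X Y) : Prop :=
  forall (i : int) (v : vertex Q),
    let dX j l := (cdiff X j l : rep_hom _ _) v in
    let dY j l := (cdiff Y j l : rep_hom _ _) v in
    let fi := ((f : chain_map X Y) i : rep_hom _ _) v in
    (forall x : 'rV_(rdim (cobj X i) v), x *m dX i (i + 1) = 0 ->
       (x *m fi <= dY (i - 1) i)%MS -> (x <= dX (i - 1) i)%MS) /\
    (forall y : 'rV_(rdim (cobj Y i) v), y *m dY i (i + 1) = 0 ->
       exists2 x : 'rV_(rdim (cobj X i) v), x *m dX i (i + 1) = 0 &
         (y - x *m fi <= dY (i - 1) i)%MS).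

Definition Db : lincat k := localization quasi_iso.

End Representations.

Section DerivedInvariants.
Variables (k : fieldType) (Q : quiver).

Definition dshift (X : Db k Q) (n : int) : Db k Q := shift X n.

(* The class of X in K_0(D^b(Q)) = Z^(Q_0): [X] = sum_i (-1)^i [X^i]. *)
Definition dimvec (X : Db k Q) : {ffun vertex Q -> int} :=
  [ffun v => \sum_(i \in [set: int]) (-1) ^ i * (rdim (cobj X i) v)%:Z].

(* [X, Y]^i = dim Hom(X, Y[i]) *)
Definition hom_dim (X Y : Db k Q) (i : int) : nat := dimk (hom X (dshift Y i)).

(* <X, Y>: the sum runs over nonpositive degrees only; its support is finite. *)
Definition bracket (X Y : Db k Q) : int :=
  \sum_(i \in [set i : int | i <= 0]) (-1) ^ i * (hom_dim X Y i)%:Z.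

Definition tau (nu : functor (Db k Q) (Db k Q)) (X : Db k Q) : Db k Q :=
  nu (dshift X (-1)).

End DerivedInvariants.

(* Main.v *)
(* The Euler form of Q is computed by the Hom complex of "maps commuting with
   the arrows up to homotopy": a cochain from X to Y consists of maps
   X^i_v -> Y^j_v for every vertex v and X^i_s -> Y^j_t for every arrow s -> t,
   the latter in degree j - i + 1.  Its cocycles of degree 0 modulo boundaries
   form a functor of X that inverts quasi-isomorphisms, because over a field the
   mapping cone of a quasi-isomorphism is contractible at every vertex.  A
   cocycle of degree 0 is the same as a chain map into the path resolution of Y,
   a product over the paths of Q, which is quasi-isomorphic to Y; a Yoneda
   argument then identifies Hom(X, Y) in the localization with the cohomology in
   degree 0.  Hence the alternating sum over all i of [X, N]^i depends only on
   dim N, and Serre duality [N, tau X]^j = [X, N]^(1-j) identifies its part in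
   degrees i > 0 with - <N, tau X>. *)
From HB Require Import structures.
From mathcomp Require Import all_boot all_order all_algebra.
From mathcomp Require Import boolp classical_sets functions cardinality fsbigop.
From mathcomp Require Import zify ring.
Require Import Defs.

Set Implicit Arguments.
Unset Strict Implicit.
Unset Printing Implicit Defensive.

Import Order.TTheory GRing.Theory Num.Theory.
Local Open Scope ring_scope.

(** Morphisms of [Db] are formal terms modulo a generated congruence, with no calculus of fractions
    at hand, so the obstacle is to prove that a term does not vanish. Terms act on cocycles of
    degree 0, up to boundaries, and this action detects vanishing. Conversely, a boundary has to
    become zero in the localization: it is pulled back from the cone of an identity, where the zero
    endomorphism is a quasi-isomorphism and hence gets inverted. Homotopies along the arrows are
    unavoidable because the contraction of a mapping cone is chosen vertex by vertex and need not
    commute with the arrows. The Dynkin hypothesis enters as finiteness: the graph is a tree, so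
    there are finitely many paths and the path resolution is a complex of finite dimensional
    representations. The truncated brackets are not determined by dimension vectors. Only the
    difference <X,N> - <N,tau X> is, and the claim is a rearrangement of its equality for M and
    N. *)

Definition dfam (k : pzRingType) (I : Type) (V : I -> lmodType k) := forall i, V i.

(** * Products of modules indexed by a type, for families of matrices of varying sizes *)

Section DependentFamilies.
Variables (k : pzRingType) (I : Type) (V : I -> lmodType k).
Implicit Types f g h : dfam V.

HB.instance Definition _ := gen_eqMixin (dfam V).
HB.instance Definition _ := gen_choiceMixin (dfam V).

Definition dfam_zero : dfam V := fun i => 0.
Definition dfam_add f g : dfam V := fun i => f i + g i.
Definition dfam_opp f : dfam V := fun i => - f i.
Definition dfam_scale a f : dfam V := fun i => a *: f i.

Lemma dfam_eq f g : (forall i, f i = g i) -> f = g.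
Proof. exact: functional_extensionality_dep. Qed.

Lemma dfam_addA : associative dfam_add.
Proof. by move=> f g h; apply: dfam_eq => i; apply: addrA. Qed.
Lemma dfam_addC : commutative dfam_add.
Proof. by move=> f g; apply: dfam_eq => i; apply: addrC. Qed.
Lemma dfam_add0 : left_id dfam_zero dfam_add.
Proof. by move=> f; apply: dfam_eq => i; apply: add0r. Qed.
Lemma dfam_addN : left_inverse dfam_zero dfam_opp dfam_add.
Proof. by move=> f; apply: dfam_eq => i; apply: addNr. Qed.

HB.instance Definition _ := GRing.isZmodule.Build (dfam V)
  dfam_addA dfam_addC dfam_add0 dfam_addN.

Lemma dfam_scaleA a b f : dfam_scale a (dfam_scale b f) = dfam_scale (a * b) f.
Proof. by apply: dfam_eq => i; apply: scalerA. Qed.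
Lemma dfam_scale1 : left_id 1 dfam_scale.
Proof. by move=> f; apply: dfam_eq => i; apply: scale1r. Qed.
Lemma dfam_scaleDr : right_distributive dfam_scale +%R.
Proof. by move=> a f g; apply: dfam_eq => i; apply: scalerDr. Qed.
Lemma dfam_scaleDl f : {morph dfam_scale^~ f : a b / a + b}.
Proof. by move=> a b; apply: dfam_eq => i; apply: scalerDl. Qed.

HB.instance Definition _ := GRing.Zmodule_isLmodule.Build k (dfam V)
  dfam_scaleA dfam_scale1 dfam_scaleDr dfam_scaleDl.

Lemma dfam0 i : (0 : dfam V) i = 0. Proof. by []. Qed.

End DependentFamilies.

(** * Complexes of representations, seen as matrices indexed by degrees and vertices *)

Section Complexes.
Variables (k : fieldType) (Q : quiver).

Definition cx := complex (reps k Q).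
Implicit Types X Y : cx.

Definition vdim X i v : nat := rdim (cobj X i) v.
Definition vdif X i j v : 'M[k]_(vdim X i v, vdim X j v) :=
  (cdiff X i j : rep_hom _ _) v.
Definition vmap X i a : 'M[k]_(vdim X i (source a), vdim X i (target a)) :=
  rmap (cobj X i) a.
Definition vcm X Y (f : chain_map X Y) i v : 'M[k]_(vdim X i v, vdim Y i v) :=
  (f i : rep_hom _ _) v.

Lemma vdif_deg X i j v : j != i + 1 -> vdif X i j v = 0.
Proof. by move=> ij; rewrite /vdif cdiff_deg. Qed.

Lemma vdif_sq X i j l v : vdif X i j v *m vdif X j l v = 0.
Proof.
have := @cdiff_sq _ _ X i j l.
by move/(congr1 (fun f : rep_hom _ _ => f v)).
Qed.

Lemma vdif_map X i j a :
  vdif X i j (source a) *m vmap X j a = vmap X i a *m vdif X i j (target a).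
Proof. exact: rhomP. Qed.

Lemma vcm_map X Y (f : chain_map X Y) i a :
  vcm f i (source a) *m vmap Y i a = vmap X i a *m vcm f i (target a).
Proof. exact: rhomP. Qed.

Lemma vcm_dif X Y (f : chain_map X Y) i j v :
  vcm f i v *m vdif Y i j v = vdif X i j v *m vcm f j v.
Proof.
have := @cmapP _ _ _ _ f i j.
by move/(congr1 (fun f : rep_hom _ _ => f v)).
Qed.

Lemma vcm_eq X Y (f g : chain_map X Y) :
  (forall i v, vcm f i v = vcm g i v) -> f = g.
Proof.
by move=> fg; apply: chain_map_eq => i; apply: rep_hom_eq => v; apply: fg.
Qed.

Lemma vcm_lin X Y (c : k) (f g : chain_map X Y) i v :
  vcm (c *: f + g) i v = c *: vcm f i v + vcm g i v.
Proof. by rewrite /vcm chain_linE rep_linE. Qed.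

Lemma vcm_comp X Y Z (f : chain_map X Y) (g : chain_map Y Z) i v :
  vcm (chain_comp f g) i v = vcm f i v *m vcm g i v.
Proof. by []. Qed.

Lemma vcm0 X Y i v : vcm (0 : chain_map X Y) i v = 0.
Proof. by []. Qed.

Lemma vdim_bounded X : exists b : nat, forall i v, (b < `|i|)%N -> vdim X i v = 0%N.
Proof.
have [b bP] := cbounded X; exists b => i v /bP /(congr1 (fun f : rep_hom _ _ => f v)).
rewrite /= -/(vdim X i v); case: (vdim X i v) => // n.
by move/eqP; rewrite /= -[_ == _]/(1%:M == 0 :> 'M_n.+1) oner_eq0.
Qed.

Section Builders.
Variables (n : int -> vertex Q -> nat).
Variable r : forall i a, 'M[k]_(n i (source a), n i (target a)).
Variable d : forall i j v, 'M[k]_(n i v, n j v).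
Hypothesis dr : forall i j a, d i j (source a) *m r j a = r i a *m d i j (target a).
Hypothesis ddeg : forall i j v, j != i + 1 -> d i j v = 0.
Hypothesis dsq : forall i j l v, d i j v *m d j l v = 0.
Hypothesis bnd : exists b : nat, forall i v, (b < `|i|)%N -> 1%:M = 0 :> 'M[k]_(n i v).

Definition mk_rep i : rep k Q := Rep (r i).
Definition mk_dif i j : rep_hom (mk_rep i) (mk_rep j) :=
  @RepHom _ _ (mk_rep i) (mk_rep j) (d i j) (dr i j).

Fact mk_cx_deg i j : j != i + 1 -> mk_dif i j = 0.
Proof. by move=> ij; apply: rep_hom_eq => v; apply: ddeg. Qed.
Fact mk_cx_sq i j l : rep_comp (mk_dif i j) (mk_dif j l) = 0.
Proof. by apply: rep_hom_eq => v; apply: dsq. Qed.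
Fact mk_cx_bnd : exists b : nat, forall i : int, (b < `|i|)%N -> rep_id (mk_rep i) = 0.
Proof.
by have [b bP] := bnd; exists b => i bi; apply: rep_hom_eq => v; apply: bP.
Qed.

Definition mk_cx : cx :=
  @Complex k (reps k Q) mk_rep mk_dif mk_cx_deg mk_cx_sq mk_cx_bnd.
End Builders.

Section ChainBuilder.
Variables (X Y : cx) (g : forall i v, 'M[k]_(vdim X i v, vdim Y i v)).
Hypothesis ga : forall i a,
  g i (source a) *m vmap Y i a = vmap X i a *m g i (target a).
Hypothesis gd : forall i j v, g i v *m vdif Y i j v = vdif X i j v *m g j v.

Definition mk_rhom i : @hom k (reps k Q) (X i) (Y i) :=
  @RepHom _ _ (X i) (Y i) (g i) (ga i).

Fact mk_chain_subproof i j :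
  mk_rhom i >>> cdiff Y i j = cdiff X i j >>> mk_rhom j.
Proof. by apply: rep_hom_eq => v; apply: gd. Qed.

Definition mk_chain : chain_map X Y := ChainMap mk_chain_subproof.

End ChainBuilder.

(** * The Hom complex of maps commuting with the arrows up to homotopy *)

Definition tsrc (t : vertex Q + arrow Q) :=
  match t with inl v => v | inr a => source a end.
Definition ttgt (t : vertex Q + arrow Q) :=
  match t with inl v => v | inr a => target a end.

(* An entry (i, j, t) has degree j - i if t is a vertex, j - i + 1 if t is an arrow. *)
Definition coch X Y := dfam (fun s : int * int * (vertex Q + arrow Q) =>
  'M[k]_(vdim X s.1.1 (tsrc s.2), vdim Y s.1.2 (ttgt s.2)) : lmodType k).

Definition deg_sign (i j : int) : k := (-1) ^ (j - i).

Lemma signzS (i : int) : (-1 : k) ^ (i + 1) = - (-1) ^ i.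
Proof. by rewrite expfzDr ?oppr_eq0 ?oner_eq0 // expr1z mulrN1. Qed.
Lemma signzB (i : int) : (-1 : k) ^ (i - 1) = - (-1) ^ i.
Proof. by rewrite -[X in - _ ^ X](subrK 1) signzS opprK. Qed.
Lemma deg_signSl i j : deg_sign (i + 1) j = - deg_sign i j.
Proof. by rewrite /deg_sign opprD addrA signzB. Qed.
Lemma deg_signBr i j : deg_sign i (j - 1) = - deg_sign i j.
Proof. by rewrite /deg_sign addrAC signzB. Qed.
Lemma deg_signM i j : deg_sign i j * deg_sign i j = 1.
Proof.
by rewrite /deg_sign -expfzMl // mulrNN mulr1 exp1rz.
Qed.

(** On a family of degree n the result sits at j - i = n + 1, so the sign is -(-1)^n and this is the
    usual differential of a Hom complex. Reading the sign off the position keeps the formula linear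
    on families of mixed degree. *)
Definition hom_dif X Y u w (c : forall i j, 'M[k]_(vdim X i u, vdim Y j w)) i j :
    'M[k]_(vdim X i u, vdim Y j w) :=
  c i (j - 1) *m vdif Y (j - 1) j w + deg_sign i j *: (vdif X i (i + 1) u *m c (i + 1) j).

Lemma hom_dif_lin X Y u w (x : k) (c c' : forall i j, 'M[k]_(vdim X i u, vdim Y j w)) i j :
  hom_dif (fun i j => x *: c i j + c' i j) i j = x *: hom_dif c i j + hom_dif c' i j.
Proof.
rewrite /hom_dif mulmxDl mulmxDr -scalemxAl -scalemxAr !scalerDr.
by rewrite !scalerA [deg_sign _ _ * x]mulrC addrACA.
Qed.

Lemma hom_difN X Y u w (c : forall i j, 'M[k]_(vdim X i u, vdim Y j w)) i j :
  hom_dif (fun i j => - c i j) i j = - hom_dif c i j.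
Proof. by rewrite /hom_dif mulNmx mulmxN scalerN opprD. Qed.

Lemma hom_difD X Y u w (c c' : forall i j, 'M[k]_(vdim X i u, vdim Y j w)) i j :
  hom_dif (fun i j => c i j + c' i j) i j = hom_dif c i j + hom_dif c' i j.
Proof. by rewrite /hom_dif mulmxDl mulmxDr scalerDr addrACA. Qed.

Lemma hom_difB X Y u w (c c' : forall i j, 'M[k]_(vdim X i u, vdim Y j w)) i j :
  hom_dif (fun i j => c i j - c' i j) i j = hom_dif c i j - hom_dif c' i j.
Proof. by rewrite hom_difD hom_difN. Qed.

Lemma hom_dif_sq X Y u w (c : forall i j, 'M[k]_(vdim X i u, vdim Y j w)) i j :
  hom_dif (fun i j => hom_dif c i j) i j = 0.
Proof.
rewrite /hom_dif mulmxDl mulmxDr -!mulmxA vdif_sq mulmx0 add0r.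
rewrite -scalemxAl -scalemxAr [X in _ *: (_ + _ *: X)]mulmxA vdif_sq mul0mx.
by rewrite scaler0 addr0 deg_signBr scaleNr mulmxA addNr.
Qed.

Definition arrow_dif X Y (f : forall i j v, 'M[k]_(vdim X i v, vdim Y j v)) i j a :
    'M[k]_(vdim X i (source a), vdim Y j (target a)) :=
  f i j (source a) *m vmap Y j a - vmap X i a *m f i j (target a).

Lemma arrow_dif_lin X Y (x : k) (f f' : forall i j v, 'M[k]_(vdim X i v, vdim Y j v)) i j a :
  arrow_dif (fun i j v => x *: f i j v + f' i j v) i j a = x *: arrow_dif f i j a + arrow_dif f' i j a.
Proof.
rewrite /arrow_dif mulmxDl mulmxDr -scalemxAl -scalemxAr !scalerDr.
by rewrite opprD addrACA scalerN.
Qed.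

Lemma arrow_dif_ext X Y (f f' : forall i j v, 'M[k]_(vdim X i v, vdim Y j v)) i j a :
  (forall i j v, f i j v = f' i j v) -> arrow_dif f i j a = arrow_dif f' i j a.
Proof. by move=> ff'; rewrite /arrow_dif !ff'. Qed.

Lemma arrow_difB X Y (f f' : forall i j v, 'M[k]_(vdim X i v, vdim Y j v)) i j a :
  arrow_dif (fun i j v => f i j v - f' i j v) i j a = arrow_dif f i j a - arrow_dif f' i j a.
Proof. by rewrite /arrow_dif mulmxBl mulmxBr !opprD addrACA. Qed.

Lemma hom_dif_arrow_dif X Y (f : forall i j v, 'M[k]_(vdim X i v, vdim Y j v)) i j a :
  hom_dif (fun i j => arrow_dif f i j a) i j = arrow_dif (fun i j v => hom_dif (fun i j => f i j v) i j) i j a.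
Proof.
rewrite /hom_dif /arrow_dif mulmxBl mulmxBr mulmxDl mulmxDr scalerBr.
rewrite -!scalemxAl -!scalemxAr -!mulmxA -vdif_map !mulmxA vdif_map.
by rewrite opprD addrACA.
Qed.

Definition vpart X Y (c : coch X Y) i j v : 'M[k]_(vdim X i v, vdim Y j v) :=
  c (i, j, inl v).
Definition apart X Y (c : coch X Y) a i j :
  'M[k]_(vdim X i (source a), vdim Y j (target a)) := c (i, j, inr a).

Lemma vpart_lin X Y (x : k) (c c' : coch X Y) i j v :
  vpart (x *: c + c') i j v = x *: vpart c i j v + vpart c' i j v.
Proof. by []. Qed.
Lemma apart_lin X Y (x : k) (c c' : coch X Y) a i j :
  apart (x *: c + c') a i j = x *: apart c a i j + apart c' a i j.
Proof. by []. Qed.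

Definition mk_coch X Y (f : forall i j v, 'M[k]_(vdim X i v, vdim Y j v))
    (h : forall a i j, 'M[k]_(vdim X i (source a), vdim Y j (target a))) : coch X Y :=
  fun s => match s with (i, j, inl v) => f i j v | (i, j, inr a) => h a i j end.

Lemma coch_eq X Y (c c' : coch X Y) :
  (forall i j v, vpart c i j v = vpart c' i j v) ->
  (forall a i j, apart c a i j = apart c' a i j) -> c = c'.
Proof. by move=> cv ca; apply: dfam_eq => -[[i j] [v|a]]; [apply: cv|apply: ca]. Qed.

(** The shifted mapping cone of the commutator [arrow_dif], from the Hom complexes at the vertices
    to those along the arrows; the minus sign makes the square zero. For two representations in
    degree 0 its cohomology is Hom and Ext^1, by the standard two-term resolution over the path
    algebra. *)
Definition cdel X Y (c : coch X Y) : coch X Y :=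
  mk_coch (fun i j v => hom_dif (fun i j => vpart c i j v) i j)
      (fun a i j => arrow_dif (vpart c) i j a - hom_dif (apart c a) i j).

Lemma vpart_cdel X Y (c : coch X Y) i j v :
  vpart (cdel c) i j v = hom_dif (fun i j => vpart c i j v) i j.
Proof. by []. Qed.
Lemma apart_cdel X Y (c : coch X Y) a i j :
  apart (cdel c) a i j = arrow_dif (vpart c) i j a - hom_dif (apart c a) i j.
Proof. by []. Qed.

Lemma cdel_lin X Y (x : k) (c c' : coch X Y) : cdel (x *: c + c') = x *: cdel c + cdel c'.
Proof.
apply: coch_eq => [i j v|a i j].
  by rewrite vpart_cdel; exact: hom_dif_lin.
rewrite apart_cdel (arrow_dif_lin x (vpart c) (vpart c')) (hom_dif_lin x (apart c a) (apart c' a)).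
by rewrite opprD addrACA -scalerBr.
Qed.

HB.instance Definition _ X Y :=
  GRing.isLinear.Build k (coch X Y) (coch X Y) *:%R (@cdel X Y) (@cdel_lin X Y).

Lemma cdel_sq X Y (c : coch X Y) : cdel (cdel c) = 0.
Proof.
apply: coch_eq => [i j v|a i j]; first by rewrite vpart_cdel; exact: hom_dif_sq.
rewrite apart_cdel /= (hom_difB (fun i j => arrow_dif (vpart c) i j a) (fun i j => hom_dif (apart c a) i j)).
by rewrite hom_dif_sq subr0 hom_dif_arrow_dif subrr.
Qed.

Definition has_deg X Y (n : int) (c : coch X Y) :=
  (forall i j v, j != i + n -> vpart c i j v = 0) /\
  (forall a i j, j != i + n - 1 -> apart c a i j = 0).

Lemma has_deg_lin X Y n (x : k) (c c' : coch X Y) : has_deg n c -> has_deg n c' -> has_deg n (x *: c + c').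
Proof.
case=> cv ca [cv' ca']; split=> [i j v|a i j] ij.
  by rewrite vpart_lin cv ?cv' // scaler0 addr0.
by rewrite apart_lin ca ?ca' // scaler0 addr0.
Qed.

Lemma has_deg0 X Y n : has_deg n (0 : coch X Y).
Proof. by split. Qed.

Lemma has_degZ X Y n x (c : coch X Y) : has_deg n c -> has_deg n (x *: c).
Proof. by move=> ?; rewrite -[_ *: _]addr0; apply: has_deg_lin => //; apply: has_deg0. Qed.

Lemma has_deg_cdel X Y n m (c : coch X Y) : m = n + 1 -> has_deg n c -> has_deg m (cdel c).
Proof.
move=> -> [cv ca]; split=> [i j v|a i j] ij.
  by rewrite vpart_cdel /hom_dif !cv ?mul0mx ?mulmx0 ?scaler0 ?addr0 //; lia.
by rewrite apart_cdel /hom_dif /arrow_dif !cv ?ca ?mul0mx ?mulmx0 ?scaler0 ?addr0 ?subrr //; lia.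
Qed.

Definition pull X' X Y (g : chain_map X' X) (c : coch X Y) : coch X' Y :=
  mk_coch (fun i j v => vcm g i v *m vpart c i j v)
      (fun a i j => vcm g i (source a) *m apart c a i j).

Lemma vpart_pull X' X Y (g : chain_map X' X) (c : coch X Y) i j v :
  vpart (pull g c) i j v = vcm g i v *m vpart c i j v.
Proof. by []. Qed.
Lemma apart_pull X' X Y (g : chain_map X' X) (c : coch X Y) a i j :
  apart (pull g c) a i j = vcm g i (source a) *m apart c a i j.
Proof. by []. Qed.

Lemma pull_lin X' X Y (g : chain_map X' X) (x : k) (c c' : coch X Y) :
  pull g (x *: c + c') = x *: pull g c + pull g c'.
Proof.
apply: coch_eq => [i j v|a i j].
  by rewrite vpart_lin /vpart /= mulmxDr -scalemxAr.
by rewrite apart_lin /apart /= mulmxDr -scalemxAr.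
Qed.

HB.instance Definition _ X' X Y (g : chain_map X' X) :=
  GRing.isLinear.Build k (coch X Y) (coch X' Y) *:%R (pull g) (@pull_lin X' X Y g).

Lemma hom_dif_pull X' X Y u w (g : chain_map X' X)
    (c : forall i j, 'M[k]_(vdim X i u, vdim Y j w)) i j :
  hom_dif (fun i j => vcm g i u *m c i j) i j = vcm g i u *m hom_dif c i j.
Proof. by rewrite /hom_dif mulmxDr -scalemxAr !mulmxA vcm_dif. Qed.

Lemma arrow_dif_pull X' X Y (g : chain_map X' X) (f : forall i j v, 'M[k]_(vdim X i v, vdim Y j v)) i j a :
  arrow_dif (fun i j v => vcm g i v *m f i j v) i j a = vcm g i (source a) *m arrow_dif f i j a.
Proof. by rewrite /arrow_dif mulmxBr !mulmxA vcm_map. Qed.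

Lemma cdel_pull X' X Y (g : chain_map X' X) (c : coch X Y) : cdel (pull g c) = pull g (cdel c).
Proof.
apply: coch_eq => [i j v|a i j]; first by rewrite vpart_cdel; exact: hom_dif_pull.
by rewrite apart_cdel (arrow_dif_pull g (vpart c)) (hom_dif_pull g (apart c a)) -mulmxBr.
Qed.

Lemma has_deg_pull X' X Y n (g : chain_map X' X) (c : coch X Y) : has_deg n c -> has_deg n (pull g c).
Proof.
by case=> cv ca; split=> [i j v|a i j] ij;
   [rewrite /vpart /= cv|rewrite /apart /= ca] => //; rewrite mulmx0.
Qed.

Lemma pull_comp X'' X' X Y (g : chain_map X'' X') (h : chain_map X' X) (c : coch X Y) :
  pull (chain_comp g h) c = pull g (pull h c).
Proof. by apply: coch_eq => [i j v|a i j]; rewrite /vpart /apart /= mulmxA. Qed.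

Lemma pull_id X Y (c : coch X Y) : pull (chain_id X) c = c.
Proof. by apply: coch_eq => [i j v|a i j]; rewrite /vpart /apart /= mul1mx. Qed.

Lemma pull_linl X' X Y (x : k) (g h : chain_map X' X) (c : coch X Y) :
  pull (x *: g + h) c = x *: pull g c + pull h c.
Proof.
apply: coch_eq => [i j v|a i j].
  by rewrite vpart_lin !vpart_pull vcm_lin mulmxDl -scalemxAl.
by rewrite apart_lin !apart_pull vcm_lin mulmxDl -scalemxAl.
Qed.

End Complexes.

(** * Contraction of the mapping cone of a quasi-isomorphism *)

Lemma exact_contraction (k : fieldType) (m n p q : nat)
    (A : 'M[k]_(m, n)) (B : 'M[k]_(n, p)) (C : 'M[k]_(p, q)) :
  (forall x : 'rV_n, x *m B = 0 -> (x <= A)%MS) -> B *m C = 0 ->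
  (1%:M - B *m pinvmx B) *m pinvmx A *m A
    + B *m ((1%:M - C *m pinvmx C) *m pinvmx B) = 1%:M.
Proof.
(* [1 - B B^+] has its image in the kernel of B, so it lifts through A. The factor [1 - C C^+] is
   invisible after B; it gives the second term the same shape as the first, so that consecutive
   degrees form a single homotopy. *)
move=> exB BC; rewrite mulmxKpV; last first.
  apply/row_subP => i; apply: exB.
  by rewrite -row_mul mulmxBl mul1mx mulmxKpV // subrr row0.
by rewrite [B *m (_ *m pinvmx B)]mulmxA mulmxBr mulmx1 [B *m (C *m _)]mulmxA BC mul0mx
  subr0 subrK.
Qed.

Section MatrixEntries.
Variables (k : fieldType) (m n : nat).
Implicit Types A B : 'M[k]_(m, n).
Lemma addmxE A B i j : (A + B) i j = A i j + B i j. Proof. by rewrite mxE. Qed.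
Lemma oppmxE A i j : (- A) i j = - A i j. Proof. by rewrite mxE. Qed.
Lemma scalemxE c A i j : (c *: A) i j = c * A i j. Proof. by rewrite mxE. Qed.
Lemma zeromxE i j : (0 : 'M[k]_(m, n)) i j = 0. Proof. by rewrite mxE. Qed.
End MatrixEntries.
Definition linmxE := (addmxE, oppmxE, scalemxE, zeromxE).

(** Matrix products stay opaque and become atoms entry by entry, so identities that are linear in
    them are left to [ring]. *)
Ltac mxring := apply/matrixP => ? ?; rewrite !linmxE; ring.

Section QuasiIso.
Variables (k : fieldType) (Q : quiver).
Implicit Types X Y : cx k Q.

Section Contraction.
Variables (X' X : cx k Q) (g : chain_map X' X) (u : vertex Q).
Variable qg : @quasi_iso k Q X' X g.

Local Notation d' i j := (vdif X' i j u).
Local Notation d i j := (vdif X i j u).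
Local Notation gg i := (vcm g i u).

(* Differential of the mapping cone, from X'^i + X^i0 to X'^j + X^i,
   where i = i0 + 1 and j = i + 1. *)
Let B i0 i j : 'M[k]_(vdim X' i u + vdim X i0 u, vdim X' j u + vdim X i u) :=
  block_mx (d' i j) (gg i) 0 (- d i0 i).

(** Injectivity on cohomology in degree j makes the first component of x the boundary of some y1;
    surjectivity in degree i corrects y1 by a cocycle y2, and y3 bounds what is left of the second
    component. *)
Let cone_exact i0 i j l : i = i0 + 1 -> j = i + 1 -> l = j + 1 ->
  forall x : 'rV_(vdim X' j u + vdim X i u), x *m B i j l = 0 -> (x <= B i0 i j)%MS.
Proof.
move=> -> -> -> x; rewrite -[x]hsubmxK mul_row_block.
set x1 := lsubmx x; set x2 := rsubmx x => /eqP.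
rewrite mulmx0 addr0 -[0]row_mx0 => /eqP/eq_row_mx [x1d]; rewrite mulmxN.
move/eqP; rewrite subr_eq0 => /eqP x12.
have [inj _] := qg (i0 + 1 + 1) u; have [_ sur] := qg (i0 + 1) u.
have x1g : (x1 *m gg (i0 + 1 + 1) <= d (i0 + 1 + 1 - 1) (i0 + 1 + 1))%MS.
  by rewrite x12 addrK; exact: submxMl.
have : (x1 <= d' (i0 + 1 + 1 - 1) (i0 + 1 + 1))%MS := inj x1 x1d x1g.
rewrite addrK => /submxP [y1 y1E].
have x2d : (x2 - y1 *m gg (i0 + 1)) *m d (i0 + 1) (i0 + 1 + 1) = 0.
  by rewrite mulmxBl -mulmxA vcm_dif mulmxA -y1E x12 subrr.
have [y2 y2d y2E] := sur _ x2d.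
have {y2d} y2d : y2 *m d' (i0 + 1) (i0 + 1 + 1) = 0 := y2d.
have {y2E} : (x2 - y1 *m gg (i0 + 1) - y2 *m gg (i0 + 1)
    <= d (i0 + 1 - 1) (i0 + 1))%MS := y2E.
rewrite addrK => /submxP [y3 y3E].
apply/submxP; exists (row_mx (y1 + y2) (- y3)).
rewrite /B mul_row_block mulmx0 addr0 mulmxDl y2d addr0 -y1E mulNmx mulmxN opprK.
by congr row_mx; rewrite -y3E mulmxDl -[x2 - _ - _]addrA -opprD [RHS]addrC subrK.
Qed.

Let coneM i0 i j : B i0 i j *m B i j (j + 1) = 0.
Proof.
rewrite /B mulmx_block !mulmxN !mulNmx !vdif_sq vcm_dif !mul0mx !mulmx0 !opprK !addr0.
by rewrite subrr ?oppr0 ?addr0 /block_mx ?row_mx0 ?col_mx0.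
Qed.

Let sig i0 i j : 'M[k]_(vdim X' j u + vdim X i u, vdim X' i u + vdim X i0 u) :=
  (1%:M - B i j (j + 1) *m pinvmx (B i j (j + 1))) *m pinvmx (B i0 i j).

Let sigP i0 i j l : i = i0 + 1 -> j = i + 1 -> l = j + 1 ->
  sig i0 i j *m B i0 i j + B i j l *m sig i j l = 1%:M.
Proof.
move=> ei ej el; rewrite /sig; move: (el) => ->.
by apply: exact_contraction; [apply: cone_exact|apply: coneM].
Qed.

(** The four blocks of the contraction [sig] of the cone: [ga] is a chain map inverse to g up to the
    homotopies [al] and [ep], and [be] is a second-order homotopy relating these two. *)
Lemma quasi_iso_contraction :
  exists (al : forall i j, 'M[k]_(vdim X' j u, vdim X' i u))
         (be : forall i j, 'M[k]_(vdim X' j u, vdim X i u))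
         (ga : forall i, 'M[k]_(vdim X i u, vdim X' i u))
         (ep : forall i j, 'M[k]_(vdim X j u, vdim X i u)),
  [/\ forall i j, j = i + 1 -> ga i *m d' i j = d i j *m ga j,
      forall i0 i j, i = i0 + 1 -> j = i + 1 ->
        ga i *m gg i - ep i0 i *m d i0 i - d i j *m ep i j = 1%:M,
      forall i j l, j = i + 1 -> l = j + 1 ->
        al i j *m d' i j + d' j l *m al j l + gg j *m ga j = 1%:M &
      forall i0 i j l, i = i0 + 1 -> j = i + 1 -> l = j + 1 ->
        al i j *m gg i - be i0 j *m d i0 i + d' j l *m be i l + gg j *m ep i j = 0].
Proof.
(* [sig] takes three successive degrees, but the size of each block involves only one or two of
   them; the others are filled in here and reconciled by [sigE]. *)
pose al i j := ulsubmx (sig (i - 1) i j).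
pose be i0 j := ursubmx (sig i0 (i0 + 1) j).
pose ga i := dlsubmx (sig (i - 1) i (i + 1)).
pose ep i0 i := drsubmx (sig i0 i (i + 1)).
have sigE i0 i j : i = i0 + 1 -> j = i + 1 ->
    sig i0 i j = block_mx (al i j) (be i0 j) (ga i) (ep i0 i).
  move=> -> ->; rewrite /al /be /ga /ep addrK submxK //.
have P i0 i j l (ei : i = i0 + 1) (ej : j = i + 1) (el : l = j + 1) :
   [/\ al i j *m d' i j + (d' j l *m al j l + gg j *m ga j) = 1%:M,
      al i j *m gg i - be i0 j *m d i0 i + (d' j l *m be i l + gg j *m ep i j) = 0,
      ga i *m d' i j - d i j *m ga j = 0 &
      ga i *m gg i - ep i0 i *m d i0 i - d i j *m ep i j = 1%:M].
  have := sigP ei ej el; rewrite (sigE _ _ _ ei ej) (sigE _ _ _ ej el) /B.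
  rewrite !mulmx_block add_block_mx !mulmx0 !mul0mx !addr0 !mulmxN !mulNmx !add0r.
  by rewrite scalar_mx_block => /eq_block_mx [].
exists al, be, ga, ep; split.
- move=> i j ij; have [_ _ + _] := P (i - 1) i j (j + 1) (esym (subrK _ _)) ij erefl.
  by move/eqP; rewrite subr_eq0 => /eqP.
- by move=> i0 i j ei ej; have [_ _ _ ->] := P i0 i j _ ei ej erefl.
- by move=> i j l ej el; have [+ _ _ _] := P _ i j l (esym (subrK _ _)) ej el; rewrite addrA.
by move=> i0 i j l ei ej el; have [_ + _ _] := P i0 i j l ei ej el; rewrite addrA.
Qed.

(* Acyclicity of the Hom complex out of the cone of g: the contraction gives
   psi = ga psi' + (-1)^(j-i) ep phi and chi = be phi - (-1)^(j-i) al psi'. *)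
Lemma cone_hom_acyclic Y w n
    (phi : forall i j, 'M[k]_(vdim X i u, vdim Y j w))
    (psi' : forall i j, 'M[k]_(vdim X' i u, vdim Y j w)) :
  (forall i j, hom_dif phi i j = 0) ->
  (forall i j, gg i *m phi i j = hom_dif psi' i j) ->
  (forall i j, j != i + n -> phi i j = 0) ->
  (forall i j, j != i + n - 1 -> psi' i j = 0) ->
  exists (psi : forall i j, 'M[k]_(vdim X i u, vdim Y j w))
         (chi : forall i j, 'M[k]_(vdim X' i u, vdim Y j w)),
  [/\ forall i j, phi i j = hom_dif psi i j,
      forall i j, psi' i j - gg i *m psi i j = hom_dif chi i j,
      forall i j, j != i + n - 1 -> psi i j = 0 &
      forall i j, j != i + n - 1 - 1 -> chi i j = 0].
Proof.
move=> phi0 gphi sphi spsi.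
have [al [be [ga [ep [e1 e2 e3 e4]]]]] := quasi_iso_contraction.
pose psi i j := ga i *m psi' i j + deg_sign k i j *: (ep (i - 1) i *m phi (i - 1) j).
pose chi i j := be (i - 1 - 1) i *m phi (i - 1 - 1) j
   - deg_sign k i j *: (al (i - 1) i *m psi' (i - 1) j).
have phid i j : phi i (j - 1) *m vdif Y (j - 1) j w
    = - deg_sign k i j *: (d i (i + 1) *m phi (i + 1) j).
  by apply/eqP; rewrite scaleNr -addr_eq0; apply/eqP; exact: phi0.
have psid i j : psi' i (j - 1) *m vdif Y (j - 1) j w
    = gg i *m phi i j - deg_sign k i j *: (d' i (i + 1) *m psi' (i + 1) j).
  by rewrite gphi /hom_dif addrK.
exists psi, chi; split=> i j.
(* Matrix sizes depend on degrees, so a homotopy identity applies only when its degrees match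
   syntactically; with i of the form i0 + 1, [addrK] removes every i - 1. *)
- have [i0 ->] : exists i0, i = i0 + 1 by exists (i - 1); rewrite subrK.
  rewrite -[LHS]mul1mx -(e2 i0 (i0 + 1) (i0 + 1 + 1)) // !mulmxBl.
  rewrite /hom_dif /psi !addrK mulmxDl -scalemxAl -!mulmxA psid phid.
  rewrite deg_signBr !deg_signSl !opprK mulmxBr mulmxDr -!scalemxAr scalerDr !scalerA.
  rewrite mulrN mulNr deg_signM !scaleN1r !mulmxA e1 //.
  by mxring.
- have [i0 ->] : exists i0, i = i0 + 1 + 1 by exists (i - 1 - 1); rewrite !subrK.
  move: (e4 i0 (i0 + 1) (i0 + 1 + 1) (i0 + 1 + 1 + 1) erefl erefl erefl).
  move=> /(congr1 (fun A => A *m phi (i0 + 1) j)) /=.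
  rewrite mul0mx 3!mulmxDl mulNmx => e4'.
  move: (e3 (i0 + 1) (i0 + 1 + 1) (i0 + 1 + 1 + 1) erefl erefl).
  move=> /(congr1 (fun A => A *m psi' (i0 + 1 + 1) j)) /=.
  rewrite mul1mx 2!mulmxDl => e3'.
  rewrite -e3' /hom_dif /psi /chi !addrK deg_signBr !deg_signSl !opprK.
  rewrite mulmxBl -!scalemxAl -!mulmxA phid psid mulmxBr mulmxDr -!scalemxAr deg_signSl.
  rewrite ?mulmxBr ?mulmxDr -?scalemxAr !mulmxA.
  move: e4' => /eqP; rewrite addr_eq0 => /eqP /(congr1 (fun A => - A)).
  rewrite opprK => <-.
  have ss := deg_signM k i0 j; move: (deg_sign k i0 j) ss => t tt.
  apply/matrixP=> r c; rewrite !linmxE; ring: tt.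
- move=> ij; rewrite /psi spsi // sphi ?mulmx0 ?scaler0 ?addr0 //; lia.
move=> ij; rewrite /chi spsi ?sphi ?mulmx0 ?scaler0 ?subrr //; lia.
Qed.

End Contraction.

(** The pair (z, e') is a cocycle in the cone of [pull g]. Arrow entries form a subcomplex with the
    vertex entries as quotient, and both are acyclic by [cone_hom_acyclic]: primitives are chosen at
    the vertices and then completed along the arrows. *)
Lemma coch_cone_acyclic X' X Y (g : chain_map X' X) n (z : coch X Y) (e' : coch X' Y) :
  @quasi_iso k Q X' X g -> cdel z = 0 -> pull g z = cdel e' -> has_deg n z -> has_deg (n - 1) e' ->
  exists (e : coch X Y) (x : coch X' Y),
    [/\ z = cdel e, e' - pull g e = cdel x, has_deg (n - 1) e & has_deg (n - 1 - 1) x].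
Proof.
move=> qg Dz gz [zv za] [ev ea].
have Rv v : exists psichi : (forall i j, 'M[k]_(vdim X i v, vdim Y j v))
                          * (forall i j, 'M[k]_(vdim X' i v, vdim Y j v)),
  [/\ forall i j, vpart z i j v = hom_dif psichi.1 i j,
      forall i j, vpart e' i j v - vcm g i v *m psichi.1 i j = hom_dif psichi.2 i j,
      forall i j, j != i + n - 1 -> psichi.1 i j = 0 &
      forall i j, j != i + n - 1 - 1 -> psichi.2 i j = 0].
  have := @cone_hom_acyclic X' X g v qg Y v n (fun i j => vpart z i j v) (fun i j => vpart e' i j v).
  case=> [i j|i j|i j ij|i j ij|psi [chi [? ? ? ?]]].
  - by rewrite -vpart_cdel Dz.
  - by rewrite -vpart_pull gz vpart_cdel.
  - exact: zv.
  - by apply: ev; rewrite addrA.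
  by exists (psi, chi).
pose psi i j v := (sval (cid (Rv v))).1 i j.
pose chi i j v := (sval (cid (Rv v))).2 i j.
have zE i j v : vpart z i j v = hom_dif (fun i j => psi i j v) i j.
  by have [+ _ _ _] := svalP (cid (Rv v)); apply.
have eE i j v : vpart e' i j v - vcm g i v *m psi i j v = hom_dif (fun i j => chi i j v) i j.
  by have [_ + _ _] := svalP (cid (Rv v)); apply.
have psi0 i j v : j != i + n - 1 -> psi i j v = 0.
  by have [_ _ + _] := svalP (cid (Rv v)); apply.
have chi0 i j v : j != i + n - 1 - 1 -> chi i j v = 0.
  by have [_ _ _ +] := svalP (cid (Rv v)); apply.
move: psi chi zE eE psi0 chi0 => psi chi zE eE psi0 chi0 {Rv}.
(* What the vertex primitives leave over along the arrows; it is again a cocycle of the same kind,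
   in degree n - 1. *)
pose h1 a i j := apart z a i j - arrow_dif psi i j a.
pose k1 a i j := arrow_dif chi i j a - apart e' a i j.
have dlz a i j : arrow_dif (vpart z) i j a = hom_dif (apart z a) i j.
  by apply/eqP; rewrite -subr_eq0 -apart_cdel Dz.
have h1d a i j : hom_dif (h1 a) i j = 0.
  rewrite (hom_difB (apart z a) (fun i j => arrow_dif psi i j a)) hom_dif_arrow_dif -dlz.
  by rewrite -(@arrow_dif_ext _ _ _ _ (vpart z)) // subrr.
have h1k a i j : vcm g i (source a) *m h1 a i j = hom_dif (k1 a) i j.
  rewrite (hom_difB (fun i j => arrow_dif chi i j a) (apart e' a)) hom_dif_arrow_dif mulmxBr -apart_pull gz apart_cdel.
  rewrite -arrow_dif_pull 
    -(@arrow_dif_ext _ _ _ _ (fun i j v => vpart e' i j v - vcm g i v *m psi i j v)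
        (fun i j v => hom_dif (fun i j => chi i j v) i j)) //.
  by rewrite arrow_difB; mxring.
have Ra a : exists psichi : (forall i j, 'M[k]_(vdim X i (source a), vdim Y j (target a)))
                          * (forall i j, 'M[k]_(vdim X' i (source a), vdim Y j (target a))),
  [/\ forall i j, h1 a i j = hom_dif psichi.1 i j,
      forall i j, k1 a i j - vcm g i (source a) *m psichi.1 i j = hom_dif psichi.2 i j,
      forall i j, j != i + n - 1 - 1 -> psichi.1 i j = 0 &
      forall i j, j != i + n - 1 - 1 - 1 -> psichi.2 i j = 0].
  have := @cone_hom_acyclic X' X g (source a) qg Y (target a) (n - 1) (h1 a) (k1 a).
  case=> [//|//|i j ij|i j ij|psi' [chi' [? ? p0 c0]]].
  - by rewrite /h1 /arrow_dif za ?psi0 ?mulmx0 ?mul0mx ?subrr //; lia.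
  - by rewrite /k1 /arrow_dif !chi0 ?ea ?mulmx0 ?mul0mx ?subrr //; lia.
  by exists (psi', chi'); split=> // i j ij; [apply: p0|apply: c0]; rewrite addrA.
pose psi2 a i j := (sval (cid (Ra a))).1 i j.
pose chi2 a i j := (sval (cid (Ra a))).2 i j.
have hE a i j : h1 a i j = hom_dif (psi2 a) i j.
  by have [+ _ _ _] := svalP (cid (Ra a)); apply.
have kE a i j : k1 a i j - vcm g i (source a) *m psi2 a i j = hom_dif (chi2 a) i j.
  by have [_ + _ _] := svalP (cid (Ra a)); apply.
have psi20 a i j : j != i + n - 1 - 1 -> psi2 a i j = 0.
  by have [_ _ + _] := svalP (cid (Ra a)); apply.
have chi20 a i j : j != i + n - 1 - 1 - 1 -> chi2 a i j = 0.
  by have [_ _ _ +] := svalP (cid (Ra a)); apply.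
(* [cdel] subtracts [hom_dif] on arrow entries, hence the sign of psi2; for chi2 the sign is already
   built into k1. *)
exists (mk_coch psi (fun a i j => - psi2 a i j)), (mk_coch chi chi2); split.
- apply: coch_eq => [i j v|a i j]; first exact: zE.
  by rewrite apart_cdel /= (hom_difN (psi2 a)) -hE opprK /h1 addrC subrK.
- apply: coch_eq => [i j v|a i j]; first exact: eE.
  rewrite apart_cdel -kE /k1 -[LHS]/(apart e' a i j - vcm g i (source a) *m - psi2 a i j).
  by rewrite mulmxN; mxring.
- by split=> [i j v|a i j] ij; [apply: psi0; lia|rewrite /apart /= psi20 ?oppr0 //; lia].
by split=> [i j v|a i j] ij; [apply: chi0|apply: chi20]; lia.
Qed.

End QuasiIso.

(** * Finite products of coordinate spaces, through their universal property *)

Section FiniteProducts.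
Variables (k : fieldType) (I : choiceType) (s : seq I) (n : I -> nat).

Definition prod_idx := {i : seq_sub s & 'I_(n (ssval i))}.
Definition prod_dim := #|{: prod_idx}|.

(** Coordinates are compared as natural numbers, which makes the projection meaningful for every i
    without transport between the types ['I_(n i)]. *)
Definition mx_proj i : 'M[k]_(prod_dim, n i) := \matrix_(t, j)
  ((ssval (tag (enum_val t)) == i) && (val (tagged (enum_val t)) == val j))%:R.

Definition mx_pair m (f : forall i, 'M[k]_(m, n i)) : 'M[k]_(m, prod_dim) :=
  \matrix_(r, t) f (ssval (tag (enum_val t))) r (tagged (enum_val t)).

Lemma mul_mx_proj m (A : 'M[k]_(m, prod_dim)) i (si : i \in s) r j :
  (A *m mx_proj i) r j
  = A r (enum_rank (Tagged (fun i : seq_sub s => 'I_(n (ssval i))) (i := SeqSub si) j)).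
Proof.
set t0 := enum_rank _; rewrite mxE (bigD1 t0) //= big1 ?addr0.
  by rewrite !mxE enum_rankK /= !eqxx mulr1.
move=> t tt0; rewrite mxE; case: andP => [[]|]; last by rewrite mulr0.
case: (enum_val t) (enum_valK t) => -[i' si'] j' /= et /eqP ii'.
rewrite /t0 in tt0 *; case: _ / ii' si j {t0} tt0 => si j /negP tt0 /eqP jj'.
case: tt0; apply/eqP; rewrite -et; congr enum_rank; rewrite (eq_irrelevance si' si).
by congr existT; apply: val_inj.
Qed.

Hypothesis sP : forall i, i \in s.

Lemma mx_pairK m (f : forall i, 'M[k]_(m, n i)) i : mx_pair f *m mx_proj i = f i.
Proof. by apply/matrixP => r j; rewrite mul_mx_proj mxE enum_rankK. Qed.

Lemma mx_proj_inj m (A B : 'M[k]_(m, prod_dim)) :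
  (forall i, A *m mx_proj i = B *m mx_proj i) -> A = B.
Proof.
move=> AB; apply/matrixP => r t; rewrite -[t]enum_valK.
case: (enum_val t) => -[i si] j.
by have /matrixP/(_ r j) := AB i; rewrite !mul_mx_proj.
Qed.

End FiniteProducts.

(** * Paths of the quiver and their action; cocycles of degree 0 *)

Section Paths.
Variables (k : fieldType) (Q : quiver).
Implicit Types X Y : cx k Q.

Inductive qpath : vertex Q -> vertex Q -> Type :=
| qnil v : qpath v v
| qcons a v (p : qpath (target a) v) : qpath (source a) v.

Fixpoint qcat u v (p : qpath u v) : forall w, qpath v w -> qpath u w :=
  match p with
  | qnil _ => fun w q => q
  | qcons a _ p => fun w q => qcons (qcat p q)
  end.

Definition qsnoc u a (p : qpath u (source a)) : qpath u (target a) :=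
  qcat p (qcons (qnil (target a))).

(** The components of the path resolution at u: [Iv p] stands for a value at the end of p, [Ia p]
    for a homotopy along the arrow a that follows p. *)
Inductive qidx u : Type :=
| Iv v (p : qpath u v)
| Ia a (p : qpath u (source a)).

HB.instance Definition _ u := gen_eqMixin (qidx u).
HB.instance Definition _ u := gen_choiceMixin (qidx u).

Fixpoint qact (X : cx k Q) i u v (p : qpath u v) : 'M[k]_(vdim X i u, vdim X i v) :=
  match p with
  | qnil v => 1%:M
  | qcons a v p => vmap X i a *m qact X i p
  end.

Lemma qact_snoc X i u a (p : qpath u (source a)) :
  qact X i (qsnoc p) = qact X i p *m vmap X i a.
Proof.
have qact_cat v (q : qpath u v) w (r : qpath v w) :
    qact X i (qcat q r) = qact X i q *m qact X i r.
  by elim: q r => [v' r|b v' q IH r] /=; rewrite ?mul1mx // IH mulmxA.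
by rewrite qact_cat /= mulmx1.
Qed.

Lemma qact_dif X i j u v (p : qpath u v) :
  vdif X i j u *m qact X j p = qact X i p *m vdif X i j v.
Proof.
elim: p => [w|a w p IH] /=; first by rewrite mulmx1 mul1mx.
by rewrite mulmxA vdif_map -mulmxA IH mulmxA.
Qed.

Lemma qact_vcm X Y (g : chain_map X Y) i u v (p : qpath u v) :
  vcm g i u *m qact Y i p = qact X i p *m vcm g i v.
Proof.
elim: p => [w|a w p IH] /=; first by rewrite mulmx1 mul1mx.
by rewrite mulmxA vcm_map -mulmxA IH mulmxA.
Qed.

(** Identity matrices between degrees that are equal only propositionally, such as i and i + 1 - 1;
    the value 0 elsewhere lets it occur in families over all pairs of degrees. *)
Definition deg_cast (X : cx k Q) i j v : 'M[k]_(vdim X i v, vdim X j v) :=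
  if i =P j is ReflectT e then castmx (erefl, congr1 (fun l => vdim X l v) e) 1%:M else 0.

Lemma deg_castE X i v : deg_cast X i i v = 1%:M.
Proof.
rewrite /deg_cast; case: eqP => // e.
by rewrite (eq_irrelevance e erefl) castmx_id.
Qed.

Lemma deg_cast0 X i j v : i != j -> deg_cast X i j v = 0.
Proof. by rewrite /deg_cast; case: eqP. Qed.

Lemma dif_deg_cast X i j l v : vdif X i j v *m deg_cast X j l v = (j == l)%:R *: vdif X i l v.
Proof.
by case: (eqVneq j l) => [->|jl]; rewrite ?deg_castE ?mulmx1 ?scale1r ?deg_cast0 ?mulmx0 ?scale0r.
Qed.

Lemma deg_cast_dif X i j l v : deg_cast X i j v *m vdif X j l v = (i == j)%:R *: vdif X i l v.
Proof.
by case: (eqVneq i j) => [->|jl]; rewrite ?deg_castE ?mul1mx ?scale1r ?deg_cast0 ?mul0mx ?scale0r.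
Qed.

Lemma deg_cast_map X i j a :
  deg_cast X i j (source a) *m vmap X j a = vmap X i a *m deg_cast X i j (target a).
Proof.
by case: (eqVneq i j) => [->|ij]; rewrite ?deg_castE ?mul1mx ?mulmx1 ?deg_cast0 ?mul0mx ?mulmx0.
Qed.

(** Spelled out by the next two lemmas: a chain map at each vertex and, for each arrow, a homotopy
    measuring the failure to commute with it. *)
Definition Z0 X Y (z : coch X Y) := has_deg 0 z /\ cdel z = 0.

Lemma Z0_dif X Y (z : coch X Y) i j v : Z0 z ->
  vpart z i i v *m vdif Y i j v = vdif X i j v *m vpart z j j v.
Proof.
case=> _ zD; have [->|ij] := eqVneq j (i + 1); last first.
  by rewrite !vdif_deg // mulmx0 mul0mx.
have : vpart (cdel z) i (i + 1) v = 0 by rewrite zD.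
rewrite vpart_cdel /hom_dif addrK /deg_sign [i + 1 - i]addrC addrA addNr add0r expr1z scaleN1r.
by move/eqP; rewrite subr_eq0 => /eqP.
Qed.

Lemma Z0_arrow_dif X Y (z : coch X Y) i a : Z0 z ->
  arrow_dif (vpart z) i i a = apart z a i (i - 1) *m vdif Y (i - 1) i (target a)
                     + vdif X i (i + 1) (source a) *m apart z a (i + 1) i.
Proof.
case=> _ zD; have : apart (cdel z) a i i = 0 by rewrite zD.
by rewrite apart_cdel /hom_dif /deg_sign subrr expr0z scale1r => /eqP; rewrite subr_eq0 => /eqP.
Qed.

Lemma Z0_lin X Y x (z z' : coch X Y) : Z0 z -> Z0 z' -> Z0 (x *: z + z').
Proof.
by case=> ? zD [? zD']; split; [exact: has_deg_lin|rewrite cdel_lin zD zD' scaler0 addr0].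
Qed.

Lemma Z0_pull X' X Y (g : chain_map X' X) (z : coch X Y) : Z0 z -> Z0 (pull g z).
Proof. by case=> ? zD; split; [exact: has_deg_pull|rewrite cdel_pull zD linear0]. Qed.

Definition unitc X : coch X X := mk_coch (deg_cast X) (fun a i j => 0).

Lemma unitcP X : Z0 (unitc X).
Proof.
split; first by split=> // i j v; rewrite addr0 /vpart /= => ij; rewrite deg_cast0 // eq_sym.
apply: coch_eq => [i j v|a i j]; last first.
  rewrite apart_cdel /= /arrow_dif /= /vpart /= deg_cast_map subrr /hom_dif /apart /=.
  by rewrite mul0mx mulmx0 scaler0 addr0 subrr.
rewrite vpart_cdel /hom_dif /vpart /= deg_cast_dif dif_deg_cast eq_sym subr_eq.
have [->|_] := eqVneq; last by rewrite !scale0r scaler0 addr0.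
by rewrite /deg_sign [i + 1 - i]addrC addrA addNr add0r expr1z !scale1r scaleN1r subrr.
Qed.

(** * The path resolution of a complex and strictification of cocycles *)

Section Resolution.
Variable s : forall u, seq (qidx u).
Hypothesis sP : forall u x, x \in s u.
Variable Y : cx k Q.

(** The coresolution of Y_u by the product of Y_v over paths u -> v, followed by the product of
    Y_(target a) over pairs of a path u -> source a and the arrow a, made into one complex: the
    second product lies one degree higher, hence [i - 1]. *)
Definition res_comp_dim i u (x : qidx u) : nat :=
  match x with Iv v p => vdim Y i v | Ia a p => vdim Y (i - 1) (target a) end.

Local Notation pr i u := (mx_proj k (s u) (@res_comp_dim i u)).

Definition res_dim i u := prod_dim (s u) (@res_comp_dim i u).

(** Representations are covariant in the vertex, paths out of a vertex contravariant: the new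
    component at p is the old one at b followed by p. *)
Definition res_map i b : 'M[k]_(res_dim i (source b), res_dim i (target b)) :=
  mx_pair (s _) (n := @res_comp_dim i (target b)) (fun x => match x with
    | Iv v p => pr i (source b) (Iv (qcons p))
    | Ia a p => pr i (source b) (Ia (qcons p))
    end).

Definition res_dif i j u : 'M[k]_(res_dim i u, res_dim j u) :=
  mx_pair (s u) (n := @res_comp_dim j u) (fun x => match x with
    | Iv v p => pr i u (Iv p) *m vdif Y i j v
    | Ia a p => (pr i u (Iv p) *m vmap Y i a - pr i u (Iv (qsnoc p)))
                   *m deg_cast Y i (j - 1) (target a)
                - pr i u (Ia p) *m vdif Y (i - 1) (j - 1) (target a)
    end).

Lemma res_mapV i b v (p : qpath (target b) v) :
  res_map i b *m pr i (target b) (Iv p) = pr i (source b) (Iv (qcons p)).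
Proof. exact: (mx_pairK (@sP _)). Qed.
Lemma res_mapA i b a (p : qpath (target b) (source a)) :
  res_map i b *m pr i (target b) (Ia p) = pr i (source b) (Ia (qcons p)).
Proof. exact: (mx_pairK (@sP _)). Qed.
Lemma res_difV i j u v (p : qpath u v) :
  res_dif i j u *m pr j u (Iv p) = pr i u (Iv p) *m vdif Y i j v.
Proof. exact: (mx_pairK (@sP _)). Qed.
Lemma res_difA i j u a (p : qpath u (source a)) :
  res_dif i j u *m pr j u (Ia p) =
  (pr i u (Iv p) *m vmap Y i a - pr i u (Iv (qsnoc p))) *m deg_cast Y i (j - 1) (target a)
  - pr i u (Ia p) *m vdif Y (i - 1) (j - 1) (target a).
Proof. exact: (mx_pairK (@sP _)). Qed.

Fact res_dr i j b :
  res_dif i j (source b) *m res_map j b = res_map i b *m res_dif i j (target b).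
Proof.
apply: (@mx_proj_inj _ _ _ (@res_comp_dim j (target b))) => -[v p|a p]; rewrite -!mulmxA.
  by rewrite res_mapV !res_difV mulmxA res_mapV.
by rewrite res_mapA !res_difA mulmxBr !mulmxA mulmxBr !mulmxA !res_mapV res_mapA.
Qed.

Fact res_deg i j u : j != i + 1 -> res_dif i j u = 0.
Proof.
move=> ij; apply: (@mx_proj_inj _ _ _ (@res_comp_dim j u)) => -[v p|a p]; rewrite mul0mx.
  by rewrite res_difV vdif_deg ?mulmx0.
by rewrite res_difA deg_cast0 ?vdif_deg ?mulmx0 ?subrr //; lia.
Qed.

Fact res_sq i j l u : res_dif i j u *m res_dif j l u = 0.
Proof.
apply: (@mx_proj_inj _ _ _ (@res_comp_dim l u)) => -[v p|a p]; rewrite mul0mx -!mulmxA.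
  by rewrite res_difV mulmxA res_difV -mulmxA vdif_sq mulmx0.
rewrite res_difA mulmxBr !mulmxA mulmxBr !mulmxA !res_difV res_difA.
rewrite [X in _ - X]mulmxBl -[_ *m vdif _ _ _ _ *m vdif _ _ _ _]mulmxA vdif_sq mulmx0 subr0.
rewrite -[_ *m vdif Y i j _ *m vmap _ _ _]mulmxA vdif_map mulmxA -mulmxBl.
rewrite -[_ *m vdif _ _ _ _ *m _]mulmxA dif_deg_cast -[_ *m deg_cast _ _ _ _ *m _]mulmxA deg_cast_dif.
rewrite -mulmxBr -scalerBl.
have [ij|ij] := eqVneq j (i + 1); last first.
  have [jl|jl] := eqVneq j (l - 1); first by rewrite vdif_deg ?scaler0 ?mulmx0 //; lia.
  have -> : (i == j - 1) = false by apply/eqP; lia.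
  by rewrite subrr scale0r mulmx0.
have -> : (i == j - 1) by apply/eqP; lia.
have [jl|jl] := eqVneq j (l - 1); first by rewrite subrr scale0r mulmx0.
by rewrite vdif_deg ?scaler0 ?mulmx0 //; lia.
Qed.

Fact res_bnd : exists b : nat, forall i u, (b < `|i|)%N -> 1%:M = 0 :> 'M[k]_(res_dim i u).
Proof.
have [b bP] := vdim_bounded Y; exists b.+1 => i u bi.
apply: (@mx_proj_inj _ _ _ (@res_comp_dim i u)) => -[v p|a p]; apply/matrixP => r c; exfalso.
  by move: c => /=; rewrite bP; [case|lia].
by move: c => /=; rewrite bP; [case|lia].
Qed.

Definition res : cx k Q := mk_cx res_dr res_deg res_sq res_bnd.

Section Strictify.
Variables (X : cx k Q) (z : coch X Y) (zZ : Z0 z).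

Definition strict_mx i u : 'M[k]_(vdim X i u, vdim res i u) :=
  mx_pair (s u) (n := @res_comp_dim i u) (fun x => match x with
    | Iv v p => qact X i p *m vpart z i i v
    | Ia a p => qact X i p *m apart z a i (i - 1)
    end).

Lemma strict_mxV i u v (p : qpath u v) : strict_mx i u *m pr i u (Iv p) = qact X i p *m vpart z i i v.
Proof. exact: (mx_pairK (@sP _)). Qed.
Lemma strict_mxA i u a (p : qpath u (source a)) :
  strict_mx i u *m pr i u (Ia p) = qact X i p *m apart z a i (i - 1).
Proof. exact: (mx_pairK (@sP _)). Qed.

Fact strict_mx_map i b :
  strict_mx i (source b) *m vmap res i b = vmap X i b *m strict_mx i (target b).
Proof.
apply: (@mx_proj_inj _ _ _ (@res_comp_dim i (target b))) => -[v p|a p].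
  by rewrite -!mulmxA [vmap res i b *m _]res_mapV !strict_mxV mulmxA.
by rewrite -!mulmxA [vmap res i b *m _]res_mapA !strict_mxA mulmxA.
Qed.

Fact strict_mx_dif i j u : strict_mx i u *m vdif res i j u = vdif X i j u *m strict_mx j u.
Proof.
apply: (@mx_proj_inj _ _ _ (@res_comp_dim j u)) => -[v p|a p]; rewrite -!mulmxA.
  by rewrite [vdif res i j u *m _]res_difV strict_mxV !mulmxA strict_mxV qact_dif -!mulmxA Z0_dif.
rewrite [vdif res i j u *m _]res_difA strict_mxA mulmxBr !mulmxA mulmxBr !mulmxA !strict_mxV strict_mxA.
rewrite qact_snoc.
have -> : qact X i p *m vpart z i i (source a) *m vmap Y i a
   - qact X i p *m vmap X i a *m vpart z i i (target a) = qact X i p *m arrow_dif (vpart z) i i a.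
  by rewrite /arrow_dif mulmxBr !mulmxA.
have [->|ij] := eqVneq j (i + 1); last first.
  by rewrite deg_cast0 ?mulmx0 ?vdif_deg ?mulmx0 ?mul0mx ?addr0 ?subrr //; lia.
by rewrite /res_comp_dim addrK deg_castE !mulmx1 Z0_arrow_dif // mulmxDr !mulmxA addrAC subrr add0r qact_dif.
Qed.

Definition strict : chain_map X res := mk_chain strict_mx_map strict_mx_dif.

End Strictify.

(** The universal cocycle, read off at the empty paths: every cocycle of degree 0 is its pullback
    along a chain map into [res]. *)
Definition counit : coch res Y :=
  @mk_coch k Q res Y (fun i j v => pr i v (Iv (qnil v)) *m deg_cast Y i j v)
      (fun a i j => pr i (source a) (Ia (qnil (source a))) *m deg_cast Y (i - 1) j (target a)).

Lemma counitP : Z0 counit.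
Proof.
split.
  split=> [i j v|a i j] ij; rewrite /vpart /apart /= deg_cast0 ?mulmx0 //; lia.
apply: coch_eq => [i j v|a i j].
  rewrite vpart_cdel /hom_dif /vpart /= -mulmxA deg_cast_dif [_ *m (_ *m deg_cast _ _ _ _)]mulmxA.
  rewrite [vdif res _ _ _ *m _]res_difV -mulmxA dif_deg_cast eq_sym subr_eq.
  have [->|_] := eqVneq; last by rewrite !scale0r mulmx0 scaler0 addr0.
  by rewrite /deg_sign [i + 1 - i]addrC addrA addNr add0r expr1z !scale1r scaleN1r subrr.
rewrite apart_cdel /arrow_dif /hom_dif /vpart /apart /= !mulmxA [vmap res _ _ *m _]res_mapV.
rewrite [vdif res _ _ _ *m _]res_difA addrK deg_castE mulmx1 -!mulmxA deg_cast_dif deg_cast_map.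
have [->|ij] := eqVneq i j; last first.
  have -> : (i - 1 == j - 1) = false by apply/eqP; lia.
  by rewrite deg_cast0 // !mulmx0 scale0r !mulmx0 scaler0 addr0 !subrr.
rewrite /deg_sign eqxx subrr expr0z deg_castE !mulmx1 !scale1r.
by rewrite [X in _ - X]addrC subrK subrr.
Qed.

Lemma pull_counit X (z : coch X Y) (zZ : Z0 z) : pull (strict zZ) counit = z.
Proof.
have [zv za] := zZ.1; apply: coch_eq => [i j v|a i j].
  rewrite vpart_pull /vpart /= mulmxA [vcm _ _ _ *m _]strict_mxV mul1mx.
  have [->|ij] := eqVneq i j; first by rewrite deg_castE mulmx1.
  by rewrite deg_cast0 // mulmx0 -[RHS]/(vpart z i j v) zv //; lia.
rewrite apart_pull /apart /= mulmxA [vcm _ _ _ *m _]strict_mxA mul1mx.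
have [<-|ij] := eqVneq (i - 1) j; first by rewrite deg_castE mulmx1.
by rewrite deg_cast0 // mulmx0 -[RHS]/(apart z a i j) za //; lia.
Qed.

Lemma strict_pull X' X (g : chain_map X' X) (z : coch X Y) (zZ : Z0 z) (gzZ : Z0 (pull g z)) :
  strict gzZ = chain_comp g (strict zZ).
Proof.
apply: vcm_eq => i u; rewrite vcm_comp.
apply: (@mx_proj_inj _ _ _ (@res_comp_dim i u)) => -[v p|a p]; rewrite -!mulmxA.
  by rewrite ![vcm (strict _) _ _ *m _]strict_mxV vpart_pull mulmxA -qact_vcm !mulmxA.
by rewrite ![vcm (strict _) _ _ *m _]strict_mxA apart_pull mulmxA -qact_vcm !mulmxA.
Qed.

Lemma strict_lin X x (z z' : coch X Y) (zZ : Z0 z) (zZ' : Z0 z') (lZ : Z0 (x *: z + z')) :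
  strict lZ = x *: strict zZ + strict zZ'.
Proof.
apply: vcm_eq => i u; rewrite vcm_lin.
apply: (@mx_proj_inj _ _ _ (@res_comp_dim i u)) => -[v p|a p]; rewrite mulmxDl -scalemxAl.
  by rewrite ![vcm (strict _) _ _ *m _]strict_mxV vpart_lin mulmxDr scalemxAr.
by rewrite ![vcm (strict _) _ _ *m _]strict_mxA apart_lin mulmxDr scalemxAr.
Qed.

Lemma strict_irr X (z : coch X Y) (zZ zZ' : Z0 z) : strict zZ = strict zZ'.
Proof. exact: vcm_eq. Qed.

Definition res_unit : chain_map Y res := strict (unitcP Y).

(* Minus the sum, over the factorizations p = p' a p'', of the (p', a)-component
   of y transported along p'': the homotopy contracting the resolution onto Y. *)
Fixpoint zeta i m u v (p : qpath u v) : 'M[k]_(m, res_dim i u) -> 'M[k]_(m, vdim Y (i - 1) v) :=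
  match p with
  | qnil v => fun _ => 0
  | qcons b v p => fun y => zeta p (y *m res_map i b)
      - y *m pr i (source b) (Ia (qnil (source b))) *m qact Y (i - 1) p
  end.

Lemma qcat_nil u v (p : qpath u v) : qcat p (qnil v) = p.
Proof. by elim: p => //= a w p ->. Qed.

Lemma qact_res i u v (p : qpath u v) a (q : qpath v (source a)) :
  qact res i p *m pr i v (Ia q) = pr i u (Ia (qcat p q)).
Proof.
elim: p q => [w|b w p IH] q /=; first by rewrite mul1mx.
by rewrite -mulmxA IH [vmap res i b *m _]res_mapA.
Qed.

Lemma zeta_cat i m u v w (p : qpath u v) (q : qpath v w) (y : 'M[k]_(m, res_dim i u)) :
  zeta (qcat p q) y = zeta p y *m qact Y (i - 1) q + zeta q (y *m qact res i p).
Proof.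
elim: p q y => [t|b t p IH] q y /=; first by rewrite mul0mx add0r mulmx1.
rewrite IH mulmxBl -!mulmxA; have -> : qact Y (i - 1) (qcat p q)
    = qact Y (i - 1) p *m qact Y (i - 1) q.
  by elim: p q {IH y} => [t' q|c t' p IH q] /=; rewrite ?mul1mx // IH mulmxA.
by rewrite addrAC.
Qed.

Lemma zeta_snoc i m u a (p : qpath u (source a)) (y : 'M[k]_(m, res_dim i u)) :
  zeta (qsnoc p) y = zeta p y *m vmap Y (i - 1) a - y *m pr i u (Ia p).
Proof. by rewrite zeta_cat /= !mulmx1 sub0r -mulmxA qact_res qcat_nil. Qed.

Lemma cycleV i m u (y : 'M[k]_(m, res_dim i u)) v (p : qpath u v) :
  y *m res_dif i (i + 1) u = 0 -> y *m pr i u (Iv p) *m vdif Y i (i + 1) v = 0.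
Proof. by rewrite -mulmxA -res_difV mulmxA => ->; rewrite mul0mx. Qed.

Lemma cycleA i m u (y : 'M[k]_(m, res_dim i u)) a (p : qpath u (source a)) :
  y *m res_dif i (i + 1) u = 0 ->
  y *m pr i u (Ia p) *m vdif Y (i - 1) i (target a)
  = y *m pr i u (Iv p) *m vmap Y i a - y *m pr i u (Iv (qsnoc p)).
Proof.
move=> yd; have : y *m (res_dif i (i + 1) u *m pr (i + 1) u (Ia p)) = 0.
  by rewrite mulmxA yd mul0mx.
rewrite res_difA /res_comp_dim addrK deg_castE mulmx1 !mulmxBr !mulmxA.
by move/eqP; rewrite subr_eq0 => /eqP ->.
Qed.

(** By [cycleA] each arrow of p contributes the difference of the components just after and just
    before it, both transported to the end of p, and the sum telescopes. *)
Lemma zeta_dif i m u v (p : qpath u v) (y : 'M[k]_(m, res_dim i u)) :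
  y *m res_dif i (i + 1) u = 0 ->
  zeta p y *m vdif Y (i - 1) i v
  = y *m pr i u (Iv p) - y *m pr i u (Iv (qnil u)) *m qact Y i p.
Proof.
elim: p y => [w|b w p IH] y yd /=; first by rewrite mul0mx mulmx1 subrr.
rewrite mulmxBl IH; last by rewrite -mulmxA -res_dr mulmxA yd mul0mx.
rewrite -[_ *m qact Y (i - 1) p *m _]mulmxA -qact_dif mulmxA cycleA //.
rewrite -[y *m res_map i b *m _]mulmxA res_mapV -[y *m res_map i b *m _]mulmxA res_mapV.
by rewrite mulmxBl opprB addrA subrK !mulmxA.
Qed.

Lemma res_unit_quasi_iso : @quasi_iso k Q Y res res_unit.
Proof.
move=> i u dX dY fi.
have fiV v (p : qpath u v) : fi *m pr i u (Iv p) = qact Y i p.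
  by rewrite [LHS]strict_mxV /vpart /= deg_castE mulmx1.
have fiA a (p : qpath u (source a)) : fi *m pr i u (Ia p) = 0.
  by rewrite [LHS]strict_mxA /apart /= mulmx0.
split=> [x xd /submxP [y yE]|y yd].
  (* At the vertex u, projection to the empty path is a chain map left inverse to [res_unit], so it
     sends a primitive of the image of x to a primitive of x. *)
  apply/submxP; exists (y *m pr (i - 1) u (Iv (qnil u))).
  rewrite -mulmxA -[dX _ _]/(vdif Y (i - 1) i u) -res_difV mulmxA -[X in X *m _]yE.
  by rewrite -mulmxA fiV /= mulmx1.
have yd' : y *m res_dif i (i + 1) u = 0 := yd.
exists (y *m pr i u (Iv (qnil u))); first exact: cycleV.
(* The primitive of y minus the image of its empty-path component: [zeta] settles the path
   components, and by [zeta_snoc] its failure to commute with the last arrow produces the arrow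
   components. *)
pose z : 'rV[k]_(res_dim (i - 1) u) :=
  mx_pair (s u) (n := @res_comp_dim (i - 1) u) (fun x => match x with
    | Iv v p => zeta p y
    | Ia a p => 0
    end).
have zV v (p : qpath u v) :
  z *m (pr (i - 1) u (Iv p) : 'M[k]_(_, vdim Y (i - 1) v)) = zeta p y.
  exact: (mx_pairK (@sP _)).
have zA a (p : qpath u (source a)) :
  z *m (pr (i - 1) u (Ia p) : 'M[k]_(_, vdim Y (i - 1 - 1) (target a))) = 0.
  exact: (mx_pairK (@sP _)).
apply/submxP; exists z.
apply: (@mx_proj_inj _ _ _ (@res_comp_dim i u)) => -[v p|a p]; rewrite mulmxBl -!mulmxA.
  by rewrite fiV [dY _ _ *m _]res_difV !mulmxA zV zeta_dif.
rewrite fiA !mulmx0 subr0 [dY _ _ *m _]res_difA deg_castE mulmx1 mulmxBr mulmxBr !mulmxA.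
by rewrite !zV zA mul0mx subr0 zeta_snoc opprB addrC subrK.
Qed.

End Resolution.
End Paths.

(** * The cone of an identity, through which boundaries factor *)

Section IdentityCone.
Variables (k : fieldType) (Q : quiver) (X : cx k Q).

Definition cone_dim i v := (vdim X i v + vdim X (i + 1) v)%N.
Definition cone_map i a : 'M[k]_(cone_dim i (source a), cone_dim i (target a)) :=
  block_mx (vmap X i a) 0 0 (vmap X (i + 1) a).
Definition cone_dif i j v : 'M[k]_(cone_dim i v, cone_dim j v) :=
  block_mx (vdif X i j v) 0 (deg_cast X (i + 1) j v) (- vdif X (i + 1) (j + 1) v).

Fact cone_dr i j a :
  cone_dif i j (source a) *m cone_map j a = cone_map i a *m cone_dif i j (target a).
Proof.
rewrite /cone_dif /cone_map !mulmx_block !mulmx0 !mul0mx !addr0 !add0r.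
by rewrite vdif_map deg_cast_map mulNmx vdif_map mulmxN.
Qed.

Fact cone_deg i j v : j != i + 1 -> cone_dif i j v = 0.
Proof.
move=> ij; rewrite /cone_dif !vdif_deg ?deg_cast0 //; [|lia..].
by rewrite oppr0 /block_mx !row_mx0 col_mx0.
Qed.

Fact cone_sq i j l v : cone_dif i j v *m cone_dif j l v = 0.
Proof.
rewrite /cone_dif !mulmx_block !mulmx0 !mul0mx !mulNmx !mulmxN !vdif_sq !addr0 opprK.
rewrite add0r /block_mx row_mx0 deg_cast_dif dif_deg_cast -scalerBl.
suff -> : ((i + 1 == j)%:R - (j + 1 == l)%:R) *: vdif X (i + 1) l v = 0.
  by rewrite row_mx0 col_mx0.
have [il|il] := eqVneq l (i + 1 + 1); last by rewrite vdif_deg ?scaler0.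
have -> : (i + 1 == j) = (j + 1 == l) by apply/eqP/eqP; lia.
by rewrite subrr scale0r.
Qed.

Fact cone_bnd : exists b : nat, forall i v, (b < `|i|)%N -> 1%:M = 0 :> 'M[k]_(cone_dim i v).
Proof.
have [b bP] := vdim_bounded X; exists b.+1 => i v bi; apply/matrixP => r; exfalso.
by move: r; rewrite /cone_dim !bP; [case|lia..].
Qed.

Definition cone : cx k Q := mk_cx cone_dr cone_deg cone_sq cone_bnd.

Lemma deg_castM i j l v : deg_cast X i j v *m deg_cast X j l v = (i == j)%:R *: deg_cast X i l v.
Proof.
by case: (eqVneq i j) => [->|jl]; rewrite ?deg_castE ?mul1mx ?scale1r ?[deg_cast X i j v]deg_cast0 ?mul0mx ?scale0r.
Qed.

Lemma cone_acyclic i v (x : 'rV_(cone_dim i v)) :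
  x *m cone_dif i (i + 1) v = 0 -> (x <= cone_dif (i - 1) i v)%MS.
Proof.
rewrite -[x]hsubmxK /cone_dif mul_row_block deg_castE mulmx1 -row_mx0 => /eq_row_mx [x12 _].
apply/submxP; exists (row_mx 0 (lsubmx x *m deg_cast X i (i - 1 + 1) v)).
rewrite mul_row_block !mul0mx !add0r mulmxN -!mulmxA deg_castM deg_cast_dif subrK eqxx !scale1r.
rewrite deg_castE mulmx1; congr row_mx; apply/eqP.
by rewrite -addr_eq0 [_ + _ *m _]addrC x12.
Qed.

(** Every cocycle of the cone is a boundary, so both conditions hold for any endomorphism; choosing
    0 forces the cone to vanish once quasi-isomorphisms are inverted. *)
Lemma cone_zero_quasi_iso : @quasi_iso k Q cone cone (0 : chain_map cone cone).
Proof.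
move=> i v dX dY fi; split=> [x xd _|y yd]; first exact: cone_acyclic xd.
exists 0; first by rewrite mul0mx.
by rewrite mul0mx subr0; exact: cone_acyclic yd.
Qed.

Definition cone_in i v : 'M[k]_(vdim X i v, vdim cone i v) := row_mx 1%:M 0.

Fact cone_in_map i a :
  cone_in i (source a) *m vmap cone i a = vmap X i a *m cone_in i (target a).
Proof.
rewrite /cone_in -[vmap cone i a]/(cone_map i a) /cone_map mul_row_block mul_mx_row.
by rewrite !mulmx0 !mul0mx mul1mx mulmx1 !addr0.
Qed.

Fact cone_in_dif i j v : cone_in i v *m vdif cone i j v = vdif X i j v *m cone_in j v.
Proof.
rewrite /cone_in -[vdif cone i j v]/(cone_dif i j v) /cone_dif mul_row_block mul_mx_row.
by rewrite !mulmx0 !mul0mx mul1mx mulmx1 !addr0.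
Qed.

Definition cone_incl : chain_map X cone := mk_chain cone_in_map cone_in_dif.

Variables (Y : cx k Q) (e : coch X Y).

(* The cocycle (cdel e, e) on X^i + X^(i+1): it makes cdel e factor through an
   acyclic complex.  The signs are 1 on the entries of degree 0. *)
Definition cone_ext : coch cone Y :=
  @mk_coch k Q cone Y
    (fun i j v => col_mx (vpart (cdel e) i j v) (deg_sign k i j *: vpart e (i + 1) j v))
    (fun a i j => col_mx (apart (cdel e) a i j) (- deg_sign k i j *: apart e a (i + 1) j)).

Lemma cone_ext_pull : pull cone_incl cone_ext = cdel e.
Proof.
by apply: coch_eq => [i j v|a i j]; rewrite ?vpart_pull ?apart_pull;
   rewrite [LHS]mul_row_col mul1mx mul0mx addr0.
Qed.

Lemma cone_extP : has_deg (-1) e -> Z0 cone_ext.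
Proof.
move=> de; have [dDv dDa] : has_deg 0 (cdel e) by apply: has_deg_cdel de.
have [dv da] := de; split.
  split=> [i j v|a i j] ij; [rewrite /vpart/= dDv // dv|rewrite /apart/= dDa // da];
    rewrite ?scaler0 ?col_mx0 //; lia.
apply: coch_eq => [i j v|a i j].
  rewrite vpart_cdel /hom_dif -[vdif cone i (i + 1) v]/(cone_dif i (i + 1) v) /cone_dif /vpart /=.
  rewrite mul_col_mx mul_block_col scale_col_mx add_col_mx !mul0mx addr0 deg_castE mul1mx.
  have -> : vpart (cdel e) i (j - 1) v *m vdif Y (j - 1) j v +
     deg_sign k i j *: (vdif X i (i + 1) v *m vpart (cdel e) (i + 1) j v) = 0.
    by rewrite -[LHS]/(vpart (cdel (cdel e)) i j v) cdel_sq.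
  apply: (@etrans _ _ (col_mx 0 0)); last exact: col_mx0.
  congr col_mx.
  rewrite vpart_cdel /hom_dif.
  rewrite deg_signBr !deg_signSl -!scalemxAl -!scalemxAr mulNmx.
  by mxring.
rewrite apart_cdel /arrow_dif /hom_dif -[vdif cone i (i + 1) _]/(cone_dif i (i + 1) _) /cone_dif.
rewrite -[vmap cone i a]/(cone_map i a) /cone_map /vpart /apart /=.
rewrite !mul_block_col scale_col_mx !mul0mx !addr0 add0r deg_castE mul1mx.
rewrite !mul_col_mx !(add_col_mx, opp_col_mx).
apply: (@etrans _ _ (col_mx 0 0)); last exact: col_mx0.
congr col_mx; first by rewrite -[LHS]/(apart (cdel (cdel e)) a i j) cdel_sq.
rewrite apart_cdel /hom_dif /arrow_dif.
rewrite deg_signBr !deg_signSl -!scalemxAl -!scalemxAr mulNmx.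
have ss := deg_signM k i j; move: (deg_sign k i j) ss => t tt.
by apply/matrixP=> r c; rewrite !linmxE; ring: tt.
Qed.

End IdentityCone.

(** * Morphisms of the localization as cocycles modulo boundaries *)

Section DerivedHom.
Variables (k : fieldType) (Q : quiver).
Variable s : forall u : vertex Q, seq (qidx u).
Hypothesis sP : forall u x, x \in s u.
Variable Y : cx k Q.
Implicit Types X : cx k Q.

Definition B0 X (z : coch X Y) := exists2 e : coch X Y, has_deg (-1) e & z = cdel e.

Lemma B0_lin X x (z z' : coch X Y) : B0 z -> B0 z' -> B0 (x *: z + z').
Proof.
by move=> [e de ->] [e' de' ->]; exists (x *: e + e'); [apply: has_deg_lin|rewrite cdel_lin].
Qed.

Lemma B00 X : B0 (0 : coch X Y).
Proof. by exists 0; [apply: has_deg0|rewrite linear0]. Qed.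

Lemma B0D X (z z' : coch X Y) : B0 z -> B0 z' -> B0 (z + z').
Proof. by rewrite -{2}[z]scale1r; apply: B0_lin. Qed.

Lemma B0Z X x (z : coch X Y) : B0 z -> B0 (x *: z).
Proof. by move=> Bz; rewrite -[_ *: _]addr0; apply: B0_lin => //; apply: B00. Qed.

Lemma B0N X (z : coch X Y) : B0 z -> B0 (- z).
Proof. by rewrite -scaleN1r; apply: B0Z. Qed.

Lemma B0_Z0 X (z : coch X Y) : B0 z -> Z0 z.
Proof. by move=> [e de ->]; split; [apply: has_deg_cdel de|apply: cdel_sq]. Qed.

Lemma B0_pull X' X (g : chain_map X' X) (z : coch X Y) : B0 z -> B0 (pull g z).
Proof. by move=> [e de ->]; exists (pull g e); [apply: has_deg_pull|rewrite cdel_pull]. Qed.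

Definition eqv X (z z' : coch X Y) := B0 (z - z').

Lemma eqv_refl X (z : coch X Y) : eqv z z.
Proof. by rewrite /eqv subrr; apply: B00. Qed.
Lemma eqv_sym X (z z' : coch X Y) : eqv z z' -> eqv z' z.
Proof. by move/B0N; rewrite opprB. Qed.
Lemma eqv_trans X (z z' z'' : coch X Y) : eqv z z' -> eqv z' z'' -> eqv z z''.
Proof. by move=> /B0D h /h; rewrite addrA subrK. Qed.
Lemma eqvD X (z z' w w' : coch X Y) : eqv z z' -> eqv w w' -> eqv (z + w) (z' + w').
Proof. by move=> /B0D h /h; rewrite /eqv opprD addrACA. Qed.
Lemma eqvZ X x (z z' : coch X Y) : eqv z z' -> eqv (x *: z) (x *: z').
Proof. by move=> /(B0Z x); rewrite /eqv scalerBr. Qed.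
Lemma eqv_pull X' X (g : chain_map X' X) (z z' : coch X Y) :
  eqv z z' -> eqv (pull g z) (pull g z').
Proof. by move=> /(B0_pull g); rewrite /eqv linearB. Qed.

Lemma pull_inj X' X (g : chain_map X' X) (z : coch X Y) :
  @quasi_iso k Q X' X g -> Z0 z -> B0 (pull g z) -> B0 z.
Proof.
move=> qg [zd zD] [e de gz].
have [e1 [_ [-> _ de1 _]]] := coch_cone_acyclic qg zD gz zd de.
by exists e1.
Qed.

Lemma pull_surj X' X (g : chain_map X' X) (z' : coch X' Y) :
  @quasi_iso k Q X' X g -> Z0 z' -> exists2 z : coch X Y, Z0 z & eqv (pull g z) z'.
Proof.
move=> qg [zd' zD'].
(* Acyclicity with the zero cochain in degree 1 as z: its primitive e is then a cocycle of degree 0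
   whose pullback differs from z' by a boundary. *)
have [||||e [x [De xE de dx]]] := @coch_cone_acyclic _ _ _ _ Y g 1 0 z' qg.
- by rewrite linear0.
- by rewrite linear0 zD'.
- exact: has_deg0.
- by rewrite subrr.
exists e; first by split; rewrite -?De // -[0](subrr (1 : int)).
by apply: eqv_sym; exists x.
Qed.

(** Total, with default 0 when no preimage exists, so that terms can act by a plain recursion before
    any cocycle condition is known. *)
Definition inv_pull X' X (g : chain_map X' X) (z' : coch X' Y) : coch X Y :=
  if pselect (exists z : coch X Y, Z0 z /\ eqv (pull g z) z') is left h
  then sval (cid h) else 0.

Lemma inv_pullP X' X (g : chain_map X' X) (z' : coch X' Y) :
  @quasi_iso k Q X' X g -> Z0 z' ->
  Z0 (inv_pull g z') /\ eqv (pull g (inv_pull g z')) z'.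
Proof.
move=> qg zZ'; rewrite /inv_pull; case: pselect => [h|[]]; first exact: (svalP (cid h)).
by have [z] := pull_surj qg zZ'; exists z.
Qed.

Local Notation C := (complexes (reps k Q)).
Local Notation lterm := (@loc_term k C (@quasi_iso k Q)).

(* A formal inverse acts by an arbitrary choice of preimage, so this action is
   linear and compatible with loc_eq only up to boundaries. *)
Fixpoint loc_act (X' X : C) (t : lterm X' X) : coch X Y -> coch X' Y :=
  match t with
  | LMor _ _ f => fun z => pull f z
  | LInv _ _ g _ => fun z => inv_pull g z
  | LComp _ _ _ f g => fun z => loc_act f (loc_act g z)
  | LAdd _ _ f g => fun z => loc_act f z + loc_act g z
  | LScale _ _ c f => fun z => c *: loc_act f z
  end.

Lemma loc_act_Z0 (X' X : C) (t : lterm X' X) z : Z0 z -> Z0 (loc_act t z).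
Proof.
elim: t z => {X' X} [X' X f z|X' X g Wg z zZ|X1 X2 X3 f IHf g IHg z zZ
    |X' X f IHf g IHg z zZ|X' X c f IHf z zZ] /=.
- exact: Z0_pull.
- by have [] := inv_pullP Wg zZ.
- exact/IHf/IHg.
- by rewrite -[loc_act f z]scale1r; apply: Z0_lin; [apply: IHf|apply: IHg].
rewrite -[_ *: _]addr0; apply: Z0_lin; first exact: IHf.
exact/B0_Z0/B00.
Qed.

Lemma inv_pull_uniq X' X (g : chain_map X' X) (z : coch X Y) (z' : coch X' Y) :
  @quasi_iso k Q X' X g -> Z0 z -> Z0 z' -> eqv (pull g z) z' -> eqv z (inv_pull g z').
Proof.
move=> qg zZ zZ' gz; have [iZ iE] := inv_pullP qg zZ'.
apply: (pull_inj qg); first by rewrite -[z]scale1r -scaleN1r addrC; apply: Z0_lin; rewrite ?scale1r.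
rewrite linearB; apply: eqv_trans gz _; exact: eqv_sym.
Qed.

Lemma loc_act_eqv (X' X : C) (t : lterm X' X) z z' : Z0 z -> Z0 z' ->
  eqv z z' -> eqv (loc_act t z) (loc_act t z').
Proof.
elim: t z z' => {X' X} [X' X f|X' X g Wg|X1 X2 X3 f IHf g IHg
    |X' X f IHf g IHg|X' X c f IHf] z z' zZ zZ' zz' /=.
- exact: eqv_pull.
- have [iZ iE] := inv_pullP Wg zZ; apply: inv_pull_uniq => //.
  exact: eqv_trans zz'.
- by apply: IHf; [apply: loc_act_Z0..|apply: IHg].
- by apply: eqvD; [apply: IHf|apply: IHg].
by apply: eqvZ; apply: IHf.
Qed.

Lemma loc_act_lin (X' X : C) (t : lterm X' X) x z z' : Z0 z -> Z0 z' ->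
  eqv (loc_act t (x *: z + z')) (x *: loc_act t z + loc_act t z').
Proof.
elim: t z z' => {X' X} [X' X f|X' X g Wg|X1 X2 X3 f IHf g IHg
    |X' X f IHf g IHg|X' X c f IHf] z z' zZ zZ' /=.
- by rewrite linearP; apply: eqv_refl.
- have [iZ iE] := inv_pullP Wg zZ; have [iZ' iE'] := inv_pullP Wg zZ'.
  apply: eqv_sym; apply: inv_pull_uniq => //; [exact: Z0_lin..|].
  by rewrite linearP; apply: eqvD => //; apply: eqvZ.
- apply: eqv_trans (IHf _ _ _ _); [|exact: loc_act_Z0..].
  by apply: loc_act_eqv; [apply/loc_act_Z0/Z0_lin|apply: Z0_lin; apply: loc_act_Z0|apply: IHg].
- apply: eqv_trans (eqvD (IHf _ _ zZ zZ') (IHg _ _ zZ zZ')) _.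
  by rewrite scalerDr addrACA; apply: eqv_refl.
apply: eqv_trans (eqvZ _ (IHf _ _ zZ zZ')) _.
by rewrite scalerDr !scalerA mulrC; apply: eqv_refl.
Qed.

Lemma pull0l X' X (z : coch X Y) : pull (0 : chain_map X' X) z = 0.
Proof.
by apply: coch_eq => [i j v|a i j]; rewrite ?vpart_pull ?apart_pull vcm0 mul0mx.
Qed.

(** This makes cocycles modulo boundaries a functor on the localization. Most generators hold on the
    nose; the exceptions are congruence of composition, linearity in the second factor, and the two
    inverse laws. *)
Lemma loc_act_loc_eq (X' X : C) (t t' : lterm X' X) z :
  loc_eq t t' -> Z0 z -> eqv (loc_act t z) (loc_act t' z).
Proof.
move=> tt'; elim: tt' z => {X' X t t'} //=.
- by move=> *; apply: eqv_refl.
- by move=> X' X f g _ IH z zZ; apply/eqv_sym/IH.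
- by move=> X' X f g h _ IH1 _ IH2 z zZ; apply: eqv_trans (IH1 z zZ) (IH2 z zZ).
- move=> X1 X2 X3 f f' g g' _ IHf _ IHg z zZ.
  apply: eqv_trans (IHf _ (loc_act_Z0 _ zZ)).
  by apply: loc_act_eqv; [apply: loc_act_Z0..|apply: IHg].
- by move=> X' X f f' g g' _ IHf _ IHg z zZ; apply: eqvD; [apply: IHf|apply: IHg].
- by move=> X' X c f f' _ IHf z zZ; apply: eqvZ; apply: IHf.
- by move=> X' X f g h z zZ; rewrite addrA; apply: eqv_refl.
- by move=> X' X f g z zZ; rewrite addrC; apply: eqv_refl.
- by move=> X' X f z zZ; rewrite pull0l add0r; apply: eqv_refl.
- by move=> X' X f z zZ; rewrite pull0l scaleN1r addNr; apply: eqv_refl.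
- by move=> X' X a b f z zZ; rewrite scalerA; apply: eqv_refl.
- by move=> X' X f z zZ; rewrite scale1r; apply: eqv_refl.
- by move=> X' X a f g z zZ; rewrite scalerDr; apply: eqv_refl.
- by move=> X' X a b f z zZ; rewrite scalerDl; apply: eqv_refl.
- by move=> X' X f z zZ; rewrite pull_id; apply: eqv_refl.
- by move=> X' X f z zZ; rewrite pull_id; apply: eqv_refl.
- by move=> *; apply: eqv_refl.
- by move=> *; apply: eqv_refl.
- by move=> X1 X2 X3 c f g g' z zZ; apply: loc_act_lin; apply: loc_act_Z0.
- by move=> X' X c f g z zZ; rewrite pull_linl; apply: eqv_refl.
- by move=> X1 X2 X3 f g z zZ; rewrite pull_comp; apply: eqv_refl.
- by move=> X' X g Wg z zZ; rewrite pull_id; have [] := inv_pullP Wg zZ.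
move=> X' X g Wg z zZ; rewrite pull_id; apply: eqv_sym.
by apply: inv_pull_uniq => //; [apply: Z0_pull|apply: eqv_refl].
Qed.

Local Notation W := (@quasi_iso k Q).

Definition dmor X X' (f : chain_map X X') : loc_hom W X X' := loc_pi (@LMor k C W X X' f).
Definition dinv X X' (f : chain_map X X') (Wf : W f) : loc_hom W X' X :=
  loc_pi (@LInv k C W X X' f Wf).

Lemma dmor_lin X X' x (f g : chain_map X X') :
  dmor (x *: f + g) = x *: dmor f + dmor g.
Proof. by rewrite loc_homDE; apply/loc_piP/(@loc_morD k C W). Qed.

Lemma dmor_comp X X' X'' (f : chain_map X X') (g : chain_map X' X'') :
  dmor (chain_comp f g) = loc_comp (dmor f) (dmor g).
Proof. by rewrite loc_piM; apply/loc_piP/(@loc_morComp k C W). Qed.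

Lemma dmor_inv X X' (f : chain_map X X') (Wf : W f) :
  loc_comp (dmor f) (dinv Wf) = dmor (chain_id X).
Proof. by rewrite loc_piM; apply/loc_piP/(@loc_invr k C W). Qed.

Lemma dinv_mor X X' (f : chain_map X X') (Wf : W f) :
  loc_comp (dinv Wf) (dmor f) = dmor (chain_id X').
Proof. by rewrite loc_piM; apply/loc_piP/(@loc_invl k C W). Qed.

Lemma dcomp0 X X' X'' (g : loc_hom W X' X'') : loc_comp (0 : loc_hom W X X') g = 0.
Proof. exact: (@comp0m k (localization W)). Qed.

(* On an acyclic complex the zero endomorphism is a quasi-isomorphism. *)
Lemma dmor_cone X : dmor (chain_id (cone X)) = 0.
Proof. by rewrite -(dmor_inv (cone_zero_quasi_iso X)) dcomp0. Qed.

Local Notation q := (res_unit_quasi_iso sP Y).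

(** The roof X -> res Y <- Y, whose second leg is the quasi-isomorphism [res_unit]. *)
Definition beta X (z : coch X Y) (zZ : Z0 z) : loc_hom W X Y :=
  loc_comp (dmor (strict sP zZ)) (dinv q).

Lemma beta_ext X (z z' : coch X Y) (zZ : Z0 z) (zZ' : Z0 z') : z = z' -> beta zZ = beta zZ'.
Proof. by move=> e; case: _ / e zZ' => zZ'; rewrite /beta (strict_irr _ zZ zZ'). Qed.

Lemma beta_lin X x (z z' : coch X Y) (zZ : Z0 z) (zZ' : Z0 z') (lZ : Z0 (x *: z + z')) :
  beta lZ = x *: beta zZ + beta zZ'.
Proof. by rewrite /beta (strict_lin _ zZ zZ') dmor_lin loc_homDl. Qed.

Lemma beta_pull X' X (g : chain_map X' X) (z : coch X Y) (zZ : Z0 z) (gzZ : Z0 (pull g z)) :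
  beta gzZ = loc_comp (dmor g) (beta zZ).
Proof. by rewrite /beta (strict_pull _ zZ) dmor_comp loc_homA. Qed.

(** A boundary is a pullback along [cone_incl], so by naturality its morphism factors through the
    cone of the identity of X, whose identity is zero in the localization. *)
Lemma beta_B0 X (z : coch X Y) (zZ : Z0 z) : B0 z -> beta zZ = 0.
Proof.
move=> [e de zE]; have eZ := cone_extP de.
have gZ := Z0_pull (cone_incl X) eZ.
rewrite (beta_ext zZ gZ) ?cone_ext_pull // (beta_pull eZ).
have -> : beta eZ = loc_comp (dmor (chain_id (cone X))) (beta eZ).
  by rewrite -(beta_pull eZ (Z0_pull _ eZ)); apply: beta_ext; rewrite pull_id.
by rewrite dmor_cone dcomp0; exact: (@compm0 k (localization W)).
Qed.

Lemma beta_eqv X (z z' : coch X Y) (zZ : Z0 z) (zZ' : Z0 z') : eqv z z' -> beta zZ = beta zZ'.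
Proof.
move=> zz'; have lZ : Z0 (- 1 *: z' + z) by apply: Z0_lin.
have := beta_B0 lZ; rewrite (beta_lin zZ' zZ) scaleN1r scaleN1r addrC => /(_ zz') /eqP.
by rewrite addrC subr_eq0 => /eqP.
Qed.

Lemma beta_unit : beta (unitcP Y) = dmor (chain_id Y).
Proof. exact: dmor_inv. Qed.

(** The Yoneda compatibility: applied to [unitc Y], whose image is the identity, it exhibits every
    term into Y as the image of a cocycle. *)
Lemma beta_loc_act (X' X : C) (t : lterm X' X) z (zZ : Z0 z) :
  beta (loc_act_Z0 t zZ) = loc_comp (loc_pi t) (beta zZ).
Proof.
elim: t z zZ => {X' X} [X' X f|X' X g Wg|X1 X2 X3 f IHf g IHg
    |X' X f IHf g IHg|X' X c f IHf] z zZ.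
- exact: beta_pull.
- have [_ iE] := inv_pullP Wg zZ; set iZ := loc_act_Z0 _ _.
  have gZ := Z0_pull g iZ.
  rewrite -(beta_eqv gZ zZ iE) (beta_pull iZ) loc_homA.
  by rewrite [loc_comp (loc_pi _) _](dinv_mor Wg) [RHS]loc_hom1m.
- rewrite -loc_piM -loc_homA -IHg -IHf; exact: beta_ext.
- have lZ : Z0 (1 *: loc_act f z + loc_act g z) by apply: Z0_lin; apply: loc_act_Z0.
  rewrite (beta_ext _ lZ) ?scale1r //= (beta_lin (loc_act_Z0 f zZ) (loc_act_Z0 g zZ)) IHf IHg.
  by rewrite -loc_homDl scale1r [loc_pi f + _]loc_piD.
have lZ : Z0 (c *: loc_act f z + 0) by apply: Z0_lin; [apply: loc_act_Z0|apply/B0_Z0/B00].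
rewrite (beta_ext _ lZ) ?addr0 //= (beta_lin (loc_act_Z0 f zZ) (B0_Z0 (B00 _))) IHf.
rewrite (beta_B0 _ (B00 _)) addr0 -loc_piZ.
exact/esym/(@compZl k (localization W)).
Qed.

Lemma beta_surj X (f : loc_hom W X Y) : exists z, exists zZ : Z0 z, beta zZ = f.
Proof.
exists (loc_act (repr f) (unitc Y)), (loc_act_Z0 _ (unitcP Y)).
by rewrite beta_loc_act beta_unit loc_reprK; exact: loc_homm1.
Qed.

(** Acting on [unitc Y], the term that represents [beta] gives back z up to a boundary, whereas the
    zero term gives 0. *)
Lemma beta_ker X (z : coch X Y) (zZ : Z0 z) : beta zZ = 0 -> B0 z.
Proof.
rewrite /beta loc_piM => /loc_piP /loc_act_loc_eq /(_ (unitcP Y)) /=.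
set i := inv_pull _ _; rewrite pull0l => h.
have [iZ iE] := inv_pullP q (unitcP Y).
(* [counit] pulls back to [unitc Y] along [res_unit], so it agrees with the chosen preimage up to a
   boundary. *)
have wi : eqv (counit sP Y) i.
  apply: (inv_pull_uniq q (counitP sP Y) (unitcP Y)).
  by rewrite pull_counit; apply: eqv_refl.
have := eqv_trans (eqv_pull (strict sP zZ) wi) h.
by rewrite pull_counit /eqv subr0.
Qed.

End DerivedHom.

(** * Dimensions of abstract vector spaces and of subquotients *)

Section Dimension.
Variable k : fieldType.
Implicit Types V : lmodType k.

(** A relation rather than the value [dimk], where 0 also stands for infinite dimension. *)
Definition fdim n V := inhabited (Vector.axiom n V).

Lemma fdim_bij n V (phi : 'rV[k]_n -> V) :
  linear phi -> injective phi -> (forall v, exists u, phi u = v) -> fdim n V.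
Proof.
move=> phiL phiI phiS; pose psi v := sval (cid (phiS v)).
have psiK : cancel psi phi by move=> v; exact: (svalP (cid (phiS v))).
have phiK : cancel phi psi by move=> u; apply: phiI; rewrite psiK.
constructor; exists psi; last by exists phi.
by move=> x v w; apply: phiI; rewrite phiL !psiK.
Qed.

Lemma fdim_uniq m n V : fdim m V -> fdim n V -> m = n.
Proof.
suff le p q : fdim p V -> fdim q V -> (p <= q)%N.
  by move=> mV nV; apply/eqP; rewrite eqn_leq !le.
move=> [[f fL [f' fK f'K]]] [[g gL [g' gK g'K]]].
pose fl := GRing.isLinear.Build _ _ _ _ f fL; pose F : {linear V -> 'rV[k]_p} := HB.pack f fl.
pose gl := GRing.isLinear.Build _ _ _ _ g gL; pose G : {linear V -> 'rV[k]_q} := HB.pack g gl.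
have f'L : linear f' by move=> x u v; apply: (can_inj fK); rewrite fL !f'K.
have g'L : linear g' by move=> x u v; apply: (can_inj gK); rewrite gL !g'K.
pose f'l := GRing.isLinear.Build _ _ _ _ f' f'L.
pose F' : {linear 'rV[k]_p -> V} := HB.pack f' f'l.
pose g'l := GRing.isLinear.Build _ _ _ _ g' g'L.
pose G' : {linear 'rV[k]_q -> V} := HB.pack g' g'l.
apply: (@mulmx1_min k _ _ (lin1_mx (G \o F')) (lin1_mx (F \o G'))).
apply/row_matrixP => i; rewrite row_mul rowE !mul_rV_lin1 /= gK f'K rowE mulmx1.
by [].
Qed.

Lemma dimkE n V : fdim n V -> dimk V = n.
Proof.
move=> nV; apply: (@fdim_uniq _ _ V) => //.
by rewrite /dimk; apply: (xgetPex 0%N (P := [set n | inhabited (Vector.axiom n V)]%classic)); exists n.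
Qed.

(** The map g identifies V with U / W, represented by the complement [U :\: W]. Linearity is asked
    on U only, since g will be extended by a default value. *)
Lemma fdim_quotient V m p N (U : 'M[k]_(m, N)) (W : 'M[k]_(p, N)) (g : 'rV[k]_N -> V) :
  (W <= U)%MS ->
  (forall x u u', (u <= U)%MS -> (u' <= U)%MS -> g (x *: u + u') = x *: g u + g u') ->
  (forall v, exists2 u, (u <= U)%MS & g u = v) ->
  (forall u, (u <= U)%MS -> g u = 0 <-> (u <= W)%MS) ->
  fdim (\rank U - \rank W) V.
Proof.
move=> WU gL gS gK; pose R := row_base (U :\: W)%MS.
have RU (x : 'rV[k]_(\rank (U :\: W)%MS)) : (x *m R <= U)%MS.
  apply: submx_trans (submxMl _ _) _; rewrite eq_row_base; exact: diffmxSl.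
have -> : (\rank U - \rank W = \rank (U :\: W)%MS)%N.
  rewrite -(mxrank_cap_compl U W); have -> : \rank (U :&: W)%MS = \rank W.
    by apply/eqP; rewrite eqn_leq !mxrankS ?capmxSr // sub_capmx WU submx_refl.
  by rewrite addKn.
have g0 : g 0 = 0 by apply/gK; rewrite sub0mx.
apply: (@fdim_bij _ _ (fun x => g (x *m R))) => [x u u'|u u' guu'|v].
- by rewrite mulmxDl -scalemxAl gL.
- apply/eqP; rewrite -subr_eq0 -(mulmx_free_eq0 _ (row_base_free (U :\: W)%MS)).
  have : ((u - u') *m R <= W)%MS.
    apply/gK => //; rewrite mulmxBl addrC -scaleN1r gL // -guu' scaleN1r addNr //.
  have : ((u - u') *m R <= U :\: W)%MS.
    by apply: submx_trans (submxMl _ _) _; rewrite eq_row_base.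
  by move=> h1 h2; rewrite -submx0 -(capmx_diff U W) sub_capmx h1 h2.
have [u uU <-] := gS v.
have : (u <= (U :\: W)%MS + (U :&: W)%MS)%MS by rewrite addsmx_diff_cap_eq.
case/sub_addsmxP => -[a b] /= uE.
have /submxP [x xE] : (a *m (U :\: W)%MS <= R)%MS by rewrite eq_row_base submxMl.
exists x; rewrite -xE uE -[a *m _]scale1r gL ?scale1r.
- have -> : g (b *m (U :&: W)%MS) = 0; last by rewrite addr0.
  apply/gK; apply: submx_trans (submxMl _ _) _; rewrite ?capmxSl ?capmxSr //.
- by apply: submx_trans (submxMl _ _) _; apply: diffmxSl.
- by apply: submx_trans (submxMl _ _) _; apply: capmxSl.
Qed.

End Dimension.

(** * Shifts of either argument of the Hom complex *)

Section Shifts.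
Variables (k : fieldType) (Q : quiver).
Implicit Types A B X Y : cx k Q.

(** What identifies cohomology in degree n + d on one side with degree d on the other. Surjectivity
    is asked on homogeneous cochains, and the nonzero scalar eps absorbs the sign of a shifted
    differential. *)
Definition shift_iso A B A' B' n (Phi : coch A B -> coch A' B') :=
  [/\ linear Phi, injective Phi,
      forall d c, has_deg (n + d) c -> has_deg d (Phi c),
      forall d c', has_deg d c' -> exists2 c, has_deg (n + d) c & Phi c = c' &
      exists2 eps : k, eps != 0 & forall c, cdel (Phi c) = eps *: Phi (cdel c)].

Lemma shift_iso_comp A B A' B' A'' B'' n m
    (Phi : coch A B -> coch A' B') (Psi : coch A' B' -> coch A'' B'') :
  shift_iso n Phi -> shift_iso m Psi -> shift_iso (n + m) (Psi \o Phi).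
Proof.
case=> L1 I1 d1 s1 [e1 e10 D1] [L2 I2 d2 s2 [e2 e20 D2]]; split.
- by move=> x c c' /=; rewrite L1 L2.
- by move=> c c' /I2 /I1.
- by move=> d c; rewrite -addrA => /d1 /d2.
- move=> d c' /s2 [c1 /s1 [c dc <-] <-]; exists c => //; by rewrite -addrA.
exists (e2 * e1) => [|c /=]; first by rewrite mulf_neq0.
have Psi0 : Psi 0 = 0.
  have := L2 1 0 0; rewrite scaler0 addr0 scale1r => /eqP.
  by rewrite -subr_eq0 opprD addrA subrr sub0r oppr_eq0 => /eqP.
by rewrite D2 D1 -[e1 *: _]addr0 L2 Psi0 addr0 scalerA.
Qed.

Lemma vpart_mk_coch X Y f h i j v : vpart (@mk_coch k Q X Y f h) i j v = f i j v.
Proof. by []. Qed.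
Lemma apart_mk_coch X Y f h a i j : apart (@mk_coch k Q X Y f h) a i j = h a i j.
Proof. by []. Qed.

Lemma hom_difZ X Y u w x (c : forall i j, 'M[k]_(vdim X i u, vdim Y j w)) i j :
  hom_dif (fun i j => x *: c i j) i j = x *: hom_dif c i j.
Proof. by rewrite /hom_dif -scalemxAl -scalemxAr scalerDr !scalerA [_ * x]mulrC. Qed.

Lemma vdif_shift X n i j v :
  vdif (shift X n) i j v = (-1) ^ n *: vdif X (i + n) (j + n) v.
Proof. exact: rep_scaleE. Qed.

Lemma signz_neq0 (n : int) : (-1 : k) ^ n != 0.
Proof. by rewrite expfz_neq0 // oppr_eq0 oner_eq0. Qed.

Lemma signzM (n : int) : (-1 : k) ^ n * (-1) ^ n = 1.
Proof. by have := deg_signM k 0 n; rewrite /deg_sign subr0. Qed.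

(** Shifting Y multiplies [hom_dif] by (-1)^n but leaves [arrow_dif] alone; the sign on arrow
    entries restores the balance, so that [cdel] is scaled as a whole. *)
Definition shiftR X Y n (c : coch X Y) : coch X (shift Y n) :=
  @mk_coch k Q X (shift Y n) (fun i j v => vpart c i (j + n) v)
      (fun a i j => (-1) ^ n *: apart c a i (j + n)).

Lemma apart_shiftR X Y n (c : coch X Y) a i j :
  apart (shiftR n c) a i j = (-1) ^ n *: apart c a i (j + n).
Proof. by []. Qed.

Lemma deg_signDr i j n : deg_sign k i (j + n) = (-1) ^ n * deg_sign k i j.
Proof. by rewrite /deg_sign -expfzDr ?oppr_eq0 ?oner_eq0 //; congr (_ ^ _); ring. Qed.

Lemma deg_signDl i j n : deg_sign k (i + n) j = (-1) ^ n * deg_sign k i j.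
Proof.
have := deg_signDr (i + n) j n; have -> : deg_sign k (i + n) (j + n) = deg_sign k i j.
  by rewrite /deg_sign; congr (_ ^ _); ring.
by move=> ->; rewrite mulrA signzM mul1r.
Qed.

Lemma hom_dif_shiftR X Y n u w (c : forall i j, 'M[k]_(vdim X i u, vdim Y j w)) i j :
  @hom_dif k Q X (shift Y n) u w (fun i j => c i (j + n)) i j = (-1) ^ n *: hom_dif c i (j + n).
Proof.
rewrite /hom_dif vdif_shift -scalemxAr scalerDr scalerA deg_signDr mulrA signzM mul1r.
by rewrite [j + n - 1]addrAC.
Qed.

Lemma shiftR_iso X Y n : shift_iso n (@shiftR X Y n).
Proof.
split.
- move=> x c c'; apply: coch_eq => [i j v|a i j]; first by [].
  by rewrite apart_lin !apart_shiftR apart_lin scalerDr !scalerA mulrC.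
- move=> c c' cc'; apply: coch_eq => [i j v|a i j].
    have : vpart c i (j - n + n) v = vpart c' i (j - n + n) v :=
      congr1 (fun c => vpart c i (j - n) v) cc'.
    by rewrite subrK.
  have : (-1) ^ n *: apart c a i (j - n + n) = (-1) ^ n *: apart c' a i (j - n + n) :=
    congr1 (fun c => apart c a i (j - n)) cc'.
  by move/(scalerI (signz_neq0 n)); rewrite subrK.
- move=> d c [cv ca]; split=> [i j v|a i j] ij.
    by rewrite vpart_mk_coch cv //; lia.
  by rewrite apart_mk_coch ca ?scaler0 //; lia.
- move=> d c' [cv ca].
  exists (mk_coch (fun i j v => vpart c' i (j - n) v *m deg_cast Y (j - n + n) j v)
      (fun a i j => (-1) ^ n *: (apart c' a i (j - n) *m deg_cast Y (j - n + n) j (target a)))).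
    split=> [i j v|a i j] ij; rewrite (vpart_mk_coch, apart_mk_coch).
      by rewrite cv ?mul0mx //; lia.
    by rewrite ca ?mul0mx ?scaler0 //; lia.
  apply: coch_eq => [i j v|a i j]; rewrite !(vpart_mk_coch, apart_mk_coch).
    by rewrite addrK deg_castE mulmx1.
  by rewrite addrK deg_castE mulmx1 scalerA signzM scale1r.
exists ((-1) ^ n) => [|c]; first exact: signz_neq0.
apply: coch_eq => [i j v|a i j].
  exact: (@hom_dif_shiftR _ _ n v v (fun i j => vpart c i j v)).
rewrite apart_cdel; have -> : hom_dif (apart (shiftR n c) a) i j
    = (-1) ^ n *: ((-1) ^ n *: hom_dif (apart c a) i (j + n)).
  rewrite -(hom_dif_shiftR n (apart c a)).
  exact: (@hom_difZ X (shift Y n) _ _ _ (fun i j => apart c a i (j + n))).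
rewrite scalerA signzM scale1r.
have -> : arrow_dif (vpart (shiftR n c)) i j a = arrow_dif (vpart c) i (j + n) a by [].
rewrite -[RHS]/((-1) ^ n *: ((-1) ^ n *: apart (cdel c) a i (j + n))).
by rewrite scalerA signzM scale1r.
Qed.

(** No sign here: the one in the differential of the shifted X cancels the change of [deg_sign]. *)
Definition shiftL X Y n (c : coch X Y) : coch (shift X n) Y :=
  @mk_coch k Q (shift X n) Y (fun i j v => vpart c (i + n) j v)
      (fun a i j => apart c a (i + n) j).

Lemma hom_dif_shiftL X Y n u w (c : forall i j, 'M[k]_(vdim X i u, vdim Y j w)) i j :
  @hom_dif k Q (shift X n) Y u w (fun i j => c (i + n) j) i j = hom_dif c (i + n) j.
Proof.
rewrite /hom_dif vdif_shift -scalemxAl scalerA deg_signDl [_ * deg_sign _ _ _]mulrC.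
by rewrite [i + n + 1]addrAC.
Qed.

Lemma shiftL_iso X Y n : shift_iso (- n) (@shiftL X Y n).
Proof.
split.
- by move=> x c c'; apply: coch_eq.
- move=> c c' cc'; apply: coch_eq => [i j v|a i j].
    have : vpart c (i - n + n) j v = vpart c' (i - n + n) j v :=
      congr1 (fun c => vpart c (i - n) j v) cc'.
    by rewrite subrK.
  have : apart c a (i - n + n) j = apart c' a (i - n + n) j :=
    congr1 (fun c => apart c a (i - n) j) cc'.
  by rewrite subrK.
- move=> d c [cv ca]; split=> [i j v|a i j] ij.
    by rewrite vpart_mk_coch cv //; lia.
  by rewrite apart_mk_coch ca //; lia.
- move=> d c' [cv ca].
  exists (mk_coch (fun i j v => deg_cast X i (i - n + n) v *m vpart c' (i - n) j v)
      (fun a i j => deg_cast X i (i - n + n) (source a) *m apart c' a (i - n) j)).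
    split=> [i j v|a i j] ij; rewrite (vpart_mk_coch, apart_mk_coch).
      by rewrite cv ?mulmx0 //; lia.
    by rewrite ca ?mulmx0 //; lia.
  apply: coch_eq => [i j v|a i j]; rewrite !(vpart_mk_coch, apart_mk_coch).
    by rewrite addrK deg_castE mul1mx.
  by rewrite addrK deg_castE mul1mx.
exists 1 => [|c]; first exact: oner_neq0.
rewrite scale1r; apply: coch_eq => [i j v|a i j].
  exact: (@hom_dif_shiftL _ _ n v v (fun i j => vpart c i j v)).
rewrite apart_cdel -[RHS]/(apart (cdel c) a (i + n) j) apart_cdel; congr (_ - _).
exact: (@hom_dif_shiftL _ _ n _ _ (apart c a)).
Qed.

End Shifts.

(** * Coordinates on homogeneous cochains, and cohomology as ranks of matrices *)

Section Coordinates.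
Variables (k : fieldType) (Q : quiver) (X Y : cx k Q) (b : nat).
Hypothesis bP : forall i v, (b < `|i|)%N -> vdim X i v = 0%N.

Definition iof (m : 'I_(b.*2.+1)) : int := (m : nat)%:Z - b%:Z.
Definition jof (n i : int) (t : vertex Q + arrow Q) : int :=
  match t with inl _ => i + n | inr _ => i + n - 1 end.

Lemma iof_inj : injective iof.
Proof. by move=> m m' /eqP; rewrite /iof => e; apply: val_inj => /=; lia. Qed.

Lemma iofP i : (`|i| <= b)%N -> exists m, i = iof m.
Proof.
move=> ib; have mb : (absz (i + b%:Z)%R < b.*2.+1)%N by lia.
by exists (Ordinal mb); rewrite /iof /=; lia.
Qed.

Definition coch_entries n (x : 'I_(b.*2.+1) * (vertex Q + arrow Q)) : finType :=
  ('I_(vdim X (iof x.1) (tsrc x.2)) * 'I_(vdim Y (jof n (iof x.1) x.2) (ttgt x.2)))%type.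
Definition coch_idx n := {x : 'I_(b.*2.+1) * (vertex Q + arrow Q) & coch_entries n x}.
Definition coch_dim n := #|{: coch_idx n}|.

Definition entry (c : coch X Y) i j t : 'M[k]_(vdim X i (tsrc t), vdim Y j (ttgt t)) :=
  c (i, j, t).

Definition coords n (c : coch X Y) : 'rV[k]_(coch_dim n) := \row_y
  let x := enum_val y in
  entry c (iof (tag x).1) (jof n (iof (tag x).1) (tag x).2) (tag x).2
    (tagged x).1 (tagged x).2.

Definition cmatch n (x : coch_idx n) i j t (r l : nat) : bool :=
  [&& iof (tag x).1 == i, jof n (iof (tag x).1) (tag x).2 == j, (tag x).2 == t,
      val (tagged x).1 == r & val (tagged x).2 == l].

Definition of_coords n (u : 'rV[k]_(coch_dim n)) : coch X Y := fun s =>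
  \matrix_(r, l) \sum_y u 0 y * (cmatch (enum_val y) s.1.1 s.1.2 s.2 (val r) (val l))%:R.

Lemma coords_lin n : linear (@coords n).
Proof. by move=> x c c'; apply/rowP => y; rewrite !mxE /entry /= !mxE. Qed.
HB.instance Definition _ n := GRing.isLinear.Build k _ _ *:%R (@coords n) (@coords_lin n).

Lemma of_coords_lin n : linear (@of_coords n).
Proof.
move=> x u u'; apply: dfam_eq => s; apply/matrixP => r l.
rewrite [RHS]mxE !mxE mulr_sumr -big_split; apply: eq_bigr => y _ /=.
by rewrite !mxE mulrDl mulrA.
Qed.
HB.instance Definition _ n := GRing.isLinear.Build k _ _ *:%R (@of_coords n) (@of_coords_lin n).

Lemma cmatch_eq n (x x' : coch_idx n) :
  cmatch x (iof (tag x').1) (jof n (iof (tag x').1) (tag x').2) (tag x').2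
    (val (tagged x').1) (val (tagged x').2) -> x = x'.
Proof.
case: x x' => [[m t] [r l]] [[m' t'] [r' l']] /and5P [] /= /eqP /iof_inj.
move=> em _ /eqP et; case: _ / em r' l' => r' l'; case: _ / et r' l' => r' l'.
by move=> /eqP er /eqP el; congr existT; congr (_, _); apply: val_inj.
Qed.

Lemma of_coordsK n : cancel (@of_coords n) (@coords n).
Proof.
move=> u; apply/rowP => y; rewrite !mxE /entry /of_coords mxE (bigD1 y) //= big1 ?addr0.
  by rewrite /cmatch !eqxx mulr1.
move=> y' yy'; case: (boolP (cmatch _ _ _ _ _ _)) => [|_]; last by rewrite mulr0.
by move=> /cmatch_eq /enum_val_inj e; rewrite e eqxx in yy'.
Qed.

Lemma of_coords_entry0 n (u : 'rV[k]_(coch_dim n)) i j t : j != jof n i t -> entry (of_coords u) i j t = 0.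
Proof.
move=> ij; apply/matrixP => r l; rewrite !mxE big1 // => y _.
case: (boolP (cmatch _ _ _ _ _ _)) => [|_]; last by rewrite mulr0.
by case/and5P => /eqP /= ei /eqP ej /eqP et _ _; rewrite -ej et ei eqxx in ij.
Qed.

Lemma has_deg_of_coords n (u : 'rV[k]_(coch_dim n)) : has_deg n (of_coords u).
Proof.
by split=> [i j v|a i j] ij; [apply: (@of_coords_entry0 n u i j (inl v))|apply: (@of_coords_entry0 n u i j (inr a))].
Qed.

Lemma has_deg_entry n (c : coch X Y) i j t : has_deg n c -> j != jof n i t -> entry c i j t = 0.
Proof. by case=> cv ca; case: t => [v|a] /=; [apply: cv|apply: ca]. Qed.

Lemma coords_eq0 n (c : coch X Y) : has_deg n c -> coords n c = 0 -> c = 0.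
Proof.
move=> dc c0; apply: dfam_eq => -[[i j] t]; rewrite dfam0 -/(entry c i j t).
have [->|/(has_deg_entry dc)//] := eqVneq j (jof n i t).
apply/matrixP => r l; rewrite [RHS]mxE.
have [ib|bi] := leqP `|i|%N b; last by exfalso; move: r; rewrite bP //; case.
have [m im] := iofP ib; case: _ / (esym im) r l => r l.
have /rowP/(_ (enum_rank (existT (fun x => coch_entries n x) (m, t) (r, l)))) := c0.
by rewrite !mxE enum_rankK.
Qed.

Lemma coordsK n (c : coch X Y) : has_deg n c -> of_coords (coords n c) = c.
Proof.
move=> dc; apply/eqP; rewrite -subr_eq0; apply/eqP; apply: (@coords_eq0 n).
  by rewrite addrC -scaleN1r; apply: has_deg_lin => //; apply: has_deg_of_coords.
by rewrite linearB /= of_coordsK subrr.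
Qed.

Definition cdel_mx n m : 'M[k]_(coch_dim n, coch_dim m) := lin1_mx (@coords m \o @cdel k Q X Y \o @of_coords n).

Lemma mul_cdel_mx n m (u : 'rV[k]_(coch_dim n)) : u *m cdel_mx n m = coords m (cdel (of_coords u)).
Proof. by rewrite mul_rV_lin1. Qed.

Lemma coords_cdel n m (c : coch X Y) : has_deg n c -> coords m (cdel c) = coords n c *m cdel_mx n m.
Proof. by move=> dc; rewrite mul_cdel_mx coordsK. Qed.

Definition hdim n : nat := (coch_dim n - \rank (cdel_mx n (n + 1)) - \rank (cdel_mx (n - 1) n))%N.

Lemma cdel_mx_sq n : (cdel_mx (n - 1) n <= kermx (cdel_mx n (n + 1)))%MS.
Proof.
apply/row_subP => i; apply/sub_kermxP; rewrite rowE [delta_mx _ _ *m _]mul_cdel_mx -coords_cdel ?cdel_sq ?linear0 //.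
by apply: has_deg_cdel (has_deg_of_coords _); rewrite subrK.
Qed.

Lemma coch_dimE n : coch_dim n = (\sum_(m < b.*2.+1) \sum_t
  vdim X (iof m) (tsrc t) * vdim Y (jof n (iof m) t) (ttgt t))%N.
Proof.
rewrite /coch_dim card_tagged sumnE big_map big_enum pair_big /=; apply: eq_bigr => -[m t] _ /=.
by rewrite card_prod !card_ord.
Qed.

Section HomDim.
Variable s : forall u : vertex Q, seq (qidx u).
Hypothesis sP : forall u x, x \in s u.

(** Kernel modulo image of the coordinate differential is carried by [Phi] to cocycles modulo
    boundaries in degree 0, and by [beta] to morphisms. *)
Lemma fdim_hom (A' B' : cx k Q) n (Phi : coch X Y -> coch A' B') :
  shift_iso n Phi -> fdim (hdim n) (@hom k (Db k Q) A' B').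
Proof.
case=> PL PI Pd Ps [eps eps0 PD].
have P0 : Phi 0 = 0.
  have := PL 1 0 0; rewrite scaler0 addr0 scale1r => /eqP.
  by rewrite -subr_eq0 opprD addrA subrr sub0r oppr_eq0 => /eqP.
have PZ x c : Phi (x *: c) = x *: Phi c by rewrite -[_ *: c]addr0 PL P0 addr0.
have dn c : has_deg n c -> has_deg 0 (Phi c) by rewrite -{1}[n]addr0; apply: Pd.
(* [beta] takes a proof of the cocycle condition; away from cocycles g has the irrelevant value
   0. *)
pose g (u : 'rV[k]_(coch_dim n)) : @hom k (Db k Q) A' B' :=
  if pselect (Z0 (Phi (of_coords u))) is left h then beta sP h else 0.
have gE u (h : Z0 (Phi (of_coords u))) : g u = beta sP h.
  by rewrite /g; case: pselect => [h'|//]; apply: beta_ext.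
have kerD u : (u <= kermx (cdel_mx n (n + 1)))%MS -> cdel (of_coords u) = 0.
  move=> /sub_kermxP; rewrite mul_cdel_mx; apply: coords_eq0.
  by apply: has_deg_cdel (has_deg_of_coords _).
have kerZ u : (u <= kermx (cdel_mx n (n + 1)))%MS -> Z0 (Phi (of_coords u)).
  by move=> /kerD uD; split; [apply/dn/has_deg_of_coords|rewrite PD uD P0 scaler0].
rewrite /hdim -mxrank_ker; apply: (@fdim_quotient _ _ _ _ _ _ _ g).
- exact: cdel_mx_sq.
- move=> x u u' uU uU'.
  rewrite (gE _ (kerZ _ uU)) (gE _ (kerZ _ uU')).
  have lZ := Z0_lin x (kerZ _ uU) (kerZ _ uU'); rewrite -(beta_lin _ _ _ lZ).
  have lZ' : Z0 (Phi (of_coords (x *: u + u'))) by rewrite linearP PL.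
  by rewrite (gE _ lZ'); apply: beta_ext; rewrite linearP PL.
- move=> f; have [z [zZ zE]] := beta_surj sP f.
  have [c dc cE] := Ps _ _ zZ.1; rewrite addr0 in dc.
  (* [Phi] is injective and commutes with the differentials up to a nonzero scalar, so it reflects
     cocycles. *)
  have cD : cdel c = 0.
    apply: PI; rewrite P0; apply: (scalerI eps0); rewrite -PD scaler0 cE; exact: zZ.2.
  exists (coords n c); first by apply/sub_kermxP; rewrite -coords_cdel // cD linear0.
  have h : Z0 (Phi (of_coords (coords n c))) by rewrite coordsK // cE.
  by rewrite gE -zE; apply: beta_ext; rewrite coordsK.
- move=> u uU; rewrite (gE _ (kerZ _ uU)); split.
    move/beta_ker => [e de eE]; have [c dc cE] := Ps _ _ de.
    have uE : of_coords u = cdel (eps *: c).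
      by apply: PI; rewrite eE -cE PD linearZ PZ.
    rewrite -[u]of_coordsK uE (@coords_cdel (n - 1)); last exact: has_degZ.
    exact: submxMl.
  case/submxP => w wE; apply: beta_B0.
  exists (eps^-1 *: Phi (of_coords w)).
    by apply/has_degZ/Pd; exact: has_deg_of_coords.
  rewrite linearZ /= PD scalerA mulVf // scale1r; congr Phi.
  rewrite wE mul_cdel_mx coordsK //; apply: has_deg_cdel (has_deg_of_coords _); by rewrite subrK.
Qed.

End HomDim.
End Coordinates.

(** * Finitely supported sums over the integers *)

Local Notation zsum f := (\sum_(i \in [set: int]%classic) f i).

Section IntegerSums.
Implicit Types f g : int -> int.

Definition window (b : nat) : seq int := [seq m%:Z - b%:Z | m <- iota 0 b.*2.+1].

Lemma mem_window b (i : int) : (`|i| <= b)%N -> i \in window b.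
Proof.
move=> ib; apply/mapP; exists (absz (i + b%:Z)%R); last by lia.
by rewrite mem_iota; lia.
Qed.

Lemma window_uniq b : uniq (window b).
Proof. by rewrite map_inj_uniq ?iota_uniq // => m n /addIr []. Qed.

Lemma zsumE b f : (forall i, (b < `|i|)%N -> f i = 0) ->
  zsum f = \sum_(i <- window b) f i.
Proof.
move=> fb; rewrite (fsbigE (window b)) => [|||i _ ib].
- by apply: eq_bigl => i; rewrite in_setT.
- exact: window_uniq.
- by [].
by apply: fb; rewrite ltnNge; apply: contra ib; apply: mem_window.
Qed.

Lemma zsumD b f g : (forall i, (b < `|i|)%N -> f i = 0) ->
  (forall i, (b < `|i|)%N -> g i = 0) -> zsum (fun i => f i + g i) = zsum f + zsum g.
Proof.
move=> fb gb; rewrite !(@zsumE b) ?big_split //= => i bi.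
by rewrite fb ?gb.
Qed.

Lemma zsum_sum (I : finType) b (F : I -> int -> int) :
  (forall t i, (b < `|i|)%N -> F t i = 0) ->
  zsum (fun i => \sum_t F t i) = \sum_t zsum (F t).
Proof.
move=> Fb; rewrite (@zsumE b) => [|i bi]; last by rewrite big1 // => t _; apply: Fb.
by rewrite exchange_big; apply: eq_bigr => t _; rewrite (@zsumE b) //; apply: Fb.
Qed.

Lemma zsum_shift n f : zsum (fun i => f (i + n)) = zsum f.
Proof.
rewrite [RHS](@reindex_fsbigT _ _ _ _ _ (fun i => i + n)) //.
by apply: (@Bijective _ _ _ (fun i => i - n)) => i; rewrite ?addrK ?subrK.
Qed.

Lemma zsum_opp n f : zsum (fun i => f (n - i)) = zsum f.
Proof.
rewrite [RHS](@reindex_fsbigT _ _ _ _ _ (fun i => n - i)) //.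
by apply: (@Bijective _ _ _ (fun i => n - i)) => i; rewrite opprB addrC subrK.
Qed.

Lemma zsum_ext f g : f =1 g -> zsum f = zsum g.
Proof. by move=> fg; apply: eq_fsbigr => i _; apply: fg. Qed.

Lemma signzD (m n : int) : (-1 : int) ^ (m + n) = (-1) ^ m * (-1) ^ n.
Proof. by rewrite exprzDr // unitrN1. Qed.

Lemma signz_sq (n : int) : (-1 : int) ^ n * (-1) ^ n = 1.
Proof. by rewrite -exprzMl ?unitrN1 // mulrNN mulr1 exp1rz. Qed.

Lemma signzN (n : int) : (-1 : int) ^ (- n) = (-1) ^ n.
Proof.
transitivity ((-1 : int) ^ (- n) * ((-1) ^ n * (-1) ^ n)); first by rewrite signz_sq mulr1.
by rewrite mulrA -signzD addNr expr0z mul1r.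
Qed.

Lemma sum_nonpos f :
  \sum_(i \in [set i : int | i <= 0]%classic) f i
  = zsum (fun i => if i <= 0 then f i else 0).
Proof.
rewrite fsbig_mkcond; apply: zsum_ext => i; rewrite /patch.
by have -> : (i \in [set i : int | i <= 0]%classic) = (i <= 0) by apply/idP/idP; rewrite in_setE.
Qed.

End IntegerSums.

(** * The Euler characteristic of the Hom complex *)

Section Euler.
Variables (k : fieldType) (Q : quiver) (X : cx k Q) (b : nat).
Hypothesis bP : forall i v, (b < `|i|)%N -> vdim X i v = 0%N.

(** The truncated subtractions in [hdim] lose nothing, because the image lies in the kernel. Writing
    the last rank with n - 1 + 1 makes it the preceding term of the same sequence of ranks. *)
Lemma hdimE Y n : (hdim X Y b n)%:Z =
  (coch_dim X Y b n)%:Z - (\rank (cdel_mx X Y b n (n + 1)))%:Z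
  - (\rank (cdel_mx X Y b (n - 1) (n - 1 + 1)))%:Z.
Proof.
rewrite /hdim; have := mxrankS (cdel_mx_sq Y bP n); rewrite mxrank_ker subrK => le.
have := rank_leq_row (cdel_mx X Y b n (n + 1)).
move: le; move: (\rank (cdel_mx X Y b n (n + 1)) : nat) => r1.
move: (\rank (cdel_mx X Y b (n - 1) n) : nat) => r2; move: (coch_dim X Y b n) => e; lia.
Qed.

Lemma coch_dim_bounded Y : exists L : nat, forall n, (L < `|n|)%N -> coch_dim X Y b n = 0%N.
Proof.
have [b' bP'] := vdim_bounded Y; exists (b + b').+1 => n nL.
rewrite coch_dimE big1 // => m _; rewrite big1 // => t _; rewrite [X in (_ * X)%N]bP' ?muln0 //.
have := ltn_ord m; rewrite /iof; case: t => _ /=; lia.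
Qed.

(** The Euler-Poincare principle: each rank occurs in two consecutive degrees with opposite
    signs. *)
Lemma zsum_hdim Y :
  zsum (fun n => (-1) ^ n * (hdim X Y b n)%:Z) = zsum (fun n => (-1) ^ n * (coch_dim X Y b n)%:Z).
Proof.
have [L LP] := coch_dim_bounded Y.
pose r n := (\rank (cdel_mx X Y b n (n + 1)))%:Z.
have r0 n : (L < `|n|)%N -> r n = 0.
  by move=> /LP e0; rewrite /r; have := rank_leq_row (cdel_mx X Y b n (n + 1)); lia.
rewrite (@zsum_ext _ (fun n => (-1) ^ n * (coch_dim X Y b n)%:Z
   + (- ((-1) ^ n * r n) + (-1) ^ (n - 1) * r (n - 1)))); last first.
  by move=> n; rewrite hdimE -/(r n) -/(r (n - 1)) signzD exprN1 invrN invr1; ring.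
(* A sum is split only when both summands have finite support; the rank in degree n - 1 accounts for
   the bound L + 1. *)
rewrite (@zsumD L.+1); last 2 first.
- by move=> n nL; rewrite LP ?mulr0 //; lia.
- by move=> n nL; rewrite !r0 ?mulr0 ?oppr0 ?addr0 //; lia.
rewrite (@zsumD L.+1); last 2 first.
- by move=> n nL; rewrite r0 ?mulr0 ?oppr0 //; lia.
- by move=> n nL; rewrite r0 ?mulr0 //; lia.
rewrite (zsum_shift (-1) (fun n => (-1) ^ n * r n)) -(@zsumD L); last 2 first.
- by move=> n nL; rewrite r0 ?mulr0 ?oppr0.
- by move=> n nL; rewrite r0 ?mulr0.
by rewrite (@fsbig1 _ _ _ _ _ (fun i => - _ + _)) ?addr0 // => n _; rewrite addNr.
Qed.

Lemma zsum_vdim Y c v :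
  zsum (fun n => (-1) ^ n * (vdim Y (n + c) v)%:Z)
  = (-1) ^ c * (dimvec (Y : Db k Q) : {ffun vertex Q -> int}) v.
Proof.
rewrite ffunE mulr_fsumr -(zsum_shift c (fun n => (-1) ^ c * ((-1) ^ n * (vdim Y n v)%:Z))).
apply: zsum_ext => n; rewrite signzD.
by transitivity (((-1) ^ c * (-1) ^ c) * ((-1) ^ n * (vdim Y (n + c) v)%:Z)); [rewrite signz_sq mul1r|ring].
Qed.

Lemma jofE n i t : jof (Q := Q) n i t = n + jof 0 i t.
Proof. by case: t => _ /=; ring. Qed.

(** For a fixed degree of X, summing over n runs through all degrees of Y, which therefore enters
    through [dimvec] alone. The -1 in [jof] at arrows gives the negative terms of the Euler form of
    Q. *)
Lemma zsum_coch_dim Y : zsum (fun n => (-1) ^ n * (coch_dim X Y b n)%:Z) =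
  \sum_m \sum_t (vdim X (iof m) (tsrc t))%:Z
    * ((-1) ^ (jof 0 (@iof b m) t) * (dimvec (Y : Db k Q) : {ffun vertex Q -> int}) (ttgt t)).
Proof.
have [b' bP'] := vdim_bounded Y.
pose F m t n := (vdim X (@iof b m) (tsrc t))%:Z
   * ((-1) ^ n * (vdim Y (n + jof 0 (iof m) t) (ttgt t))%:Z).
have F0 m t n : (b + b' + 1 < `|n|)%N -> F m t n = 0.
  move=> nb; rewrite /F [vdim Y _ _]bP' ?mulr0 //.
  by have := ltn_ord m; rewrite /iof; case: t => _ /=; lia.
rewrite (@zsum_ext _ (fun n => \sum_m \sum_t F m t n)); last first.
  move=> n; rewrite coch_dimE -natz natr_sum mulr_sumr; apply: eq_bigr => m _.
  rewrite natr_sum mulr_sumr; apply: eq_bigr => t _.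
  by rewrite natrM !natz /F jofE mulrCA.
rewrite (@zsum_sum _ (b + b' + 1)); last by move=> m n nb; rewrite big1 // => t _; apply: F0.
apply: eq_bigr => m _; rewrite (@zsum_sum _ (b + b' + 1)); last by move=> t n; apply: F0.
by apply: eq_bigr => t _; rewrite -zsum_vdim mulr_fsumr.
Qed.

Lemma euler_dimvec Y Y' : dimvec (Y : Db k Q) = dimvec (Y' : Db k Q) ->
  zsum (fun n => (-1) ^ n * (hdim X Y b n)%:Z) = zsum (fun n => (-1) ^ n * (hdim X Y' b n)%:Z).
Proof. by move=> YY'; rewrite !zsum_hdim !zsum_coch_dim YY'. Qed.

End Euler.

(** * Dimensions under Serre duality *)

Lemma serre_fdim (k : fieldType) (C : lincat k) (nu : functor C C) (X Y : C) n :
  is_serre_functor nu -> fdim n (hom X Y) -> fdim n (hom Y (nu X)).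
Proof.
case=> _ [eta [etaL etaP etaU _ _]] [[f fL [r fK rK]]].
(* Coordinates of phi: the functional attached to it by duality, evaluated on the basis of Hom(X, Y)
   given by r. *)
pose w (phi : hom Y (nu X)) : 'rV[k]_n := \row_i eta X Y phi (r (delta_mx 0 i)).
have wL : linear w by move=> c phi psi; apply/rowP => i; rewrite !mxE etaP.
have rL : linear r by move=> x u v; apply: (can_inj fK); rewrite fL !rK.
pose rl := GRing.isLinear.Build _ _ _ _ r rL.
pose R : {linear 'rV[k]_n -> hom X Y} := HB.pack r rl.
have eL phi : scalar (eta X Y phi) by move=> c g g'; rewrite etaL.
have etaE phi g : eta X Y phi g = \sum_i f g 0 i * w phi 0 i.
  pose el := GRing.isLinear.Build _ _ _ _ _ (eL phi).
  pose E : {scalar hom X Y} := HB.pack (eta X Y phi) el.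
  rewrite -[g in LHS]fK [f g in LHS]row_sum_delta -[r _]/(R _) linear_sum.
  rewrite -[LHS]/(E _) linear_sum; apply: eq_bigr => i _.
  by rewrite !linearZ /= mxE.
have wI : injective w.
  move=> phi psi ww; pose el := GRing.isLinear.Build _ _ _ _ _ (eL psi).
  have [chi [_ chiU]] := etaU X Y (HB.pack (eta X Y psi) el).
  by rewrite -(chiU psi) // (chiU phi) // => g /=; rewrite !etaE ww.
have wS u : exists phi, w phi = u.
  pose l g := \sum_i f g 0 i * u 0 i.
  have lL : scalar l.
    move=> c g g'; rewrite /l mulr_sumr -big_split; apply: eq_bigr => i _ /=.
    by rewrite fL !mxE mulrDl mulrA.
  pose ll := GRing.isLinear.Build _ _ _ _ _ lL.
  have [phi [phiE _]] := etaU X Y (HB.pack l ll); exists phi.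
  apply/rowP => i; rewrite mxE phiE /= /l rK (bigD1 i) //= mxE !eqxx mul1r big1 ?addr0 //.
  by move=> j ji; rewrite mxE eqxx (negbTE ji) mul0r.
constructor; exists w => //; exists (fun u => sval (cid (wS u))) => x.
  by apply: wI; rewrite (svalP (cid (wS _))).
exact: (svalP (cid (wS _))).
Qed.

(** * Finiteness of the set of paths of a Dynkin quiver *)

Section DynkinPaths.
Variable Q : quiver.
Implicit Types (u v w : vertex Q) (a : arrow Q).

Lemma dynkin_edge_lt t n i j : dynkin_rank_ok t n -> dynkin_edge t n i j -> (i < j)%N.
Proof. by case: t => /=; lia. Qed.

Lemma dynkin_edge_uniq t n i i' j :
  dynkin_rank_ok t n -> dynkin_edge t n i j -> dynkin_edge t n i' j -> i = i'.
Proof. by case: t => /=; lia. Qed.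

(* A Dynkin diagram is a tree in which every vertex has at most one smaller
   neighbour, so a height can be chosen vertex by vertex. *)
Lemma dynkin_height : is_dynkin Q ->
  exists h : vertex Q -> int, forall a, h (target a) = h (source a) + 1.
Proof.
case=> t [n [phi [ok phiB cardE]]].
pose p v : nat := phi v.
have pI : injective p by move=> u v /val_inj /(bij_inj phiB).
have edge a : dynkin_edge t n (p (source a)) (p (target a))
           || dynkin_edge t n (p (target a)) (p (source a)).
  apply/negPn/negP => /negbTE e0; have := cardE (source a) (target a).
  by rewrite e0 => /card0_eq /(_ a); rewrite !inE !eqxx.
have uniqa (a a' : arrow Q) : (source a' == source a) && (target a' == target a)
    || (source a' == target a) && (target a' == source a) -> a' = a.
  move=> aa'; have := cardE (source a) (target a).
  set A := [pred _ | _] => cA; have /card_le1_eqP : (#|A| <= 1)%N by rewrite cA; case: (_ || _).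
  by apply; rewrite !inE ?eqxx.
(* Vertices receive their heights one at a time, in the order of the Dynkin labelling. *)
suff /(_ n) [h hP] : forall m, exists h : vertex Q -> int, forall a,
    (p (source a) < m)%N -> (p (target a) < m)%N -> h (target a) = h (source a) + 1.
  by exists h => a; apply: hP; apply: ltn_ord.
elim=> [|m [h hP]]; first by exists (fun=> 0).
have noloop a : p (source a) != p (target a).
  by have /orP [] := edge a => /(dynkin_edge_lt ok); lia.
have down a : (p (target a) < p (source a))%N ->
    dynkin_edge t n (p (target a)) (p (source a)).
  by have /orP [/(dynkin_edge_lt ok)|//] := edge a; lia.
have up a : (p (source a) < p (target a))%N ->
    dynkin_edge t n (p (source a)) (p (target a)).
  by have /orP [//|/(dynkin_edge_lt ok)] := edge a; lia.
(* The arrows joining vertex m to those already treated: at most one, since m has at most one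
   smaller neighbour and edges are simple. *)
pose touch a := (p (source a) == m) && (p (target a) < m)%N
   || (p (target a) == m) && (p (source a) < m)%N.
have touch_uniq a a' : touch a -> touch a' -> a' = a.
  have other b : touch b -> exists i, [/\ dynkin_edge t n i m &
      (p (source b) = m /\ p (target b) = i) \/ (p (target b) = m /\ p (source b) = i)].
    case/orP => /andP [/eqP e lt].
      by exists (p (target b)); split; [rewrite -e; apply: down; rewrite e|left].
    by exists (p (source b)); split; [rewrite -e; apply: up; rewrite e|right].
  move=> /other [i [ei Ei]] /other [i' [ei' Ei']].
  move: Ei'; rewrite (dynkin_edge_uniq ok ei' ei) => Ei'; apply: uniqa.
  rewrite -!(inj_eq pI).
  by case: Ei => -[-> ->]; case: Ei' => -[-> ->]; rewrite !eqxx ?orbT.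
have [[a0 ta0]|no] := pselect (exists a, touch a); last first.
  exists h => a sm tm; have := noloop a => nl.
  have nt : ~~ touch a by apply/negP => ta; apply: no; exists a.
  by apply: hP; move: nt; rewrite /touch; lia.
(* The height of vertex m is forced by its single arrow to a smaller vertex, according to the
   direction of that arrow. *)
pose c := if p (source a0) == m then h (target a0) - 1 else h (source a0) + 1.
exists (fun v => if p v == m then c else h v) => a sm tm; have nl := noloop a.
have [ta|nt] := boolP (touch a).
  rewrite (touch_uniq _ _ ta0 ta) /c; move: ta0; rewrite /touch.
  case: eqP => [e _|_ /andP [/eqP e lt]].
    by rewrite ifF ?subrK //; move: (noloop a0); rewrite e eq_sym => /negbTE.
  by rewrite e eqxx.
by rewrite !ifF ?hP //; move: nt; rewrite /touch; lia.
Qed.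

Fixpoint qlen (u v : vertex Q) (p : qpath u v) : nat :=
  match p with qnil _ => 0%N | qcons _ _ p => (qlen p).+1 end.

Lemma qlen_height (h : vertex Q -> int) u v (p : qpath u v) :
  (forall a, h (target a) = h (source a) + 1) -> h v = h u + (qlen p)%:Z.
Proof. by move=> hP; elim: p => [w|a w p /= ->]; rewrite ?addr0 // hP; lia. Qed.

Definition idx_nil (u : vertex Q) (a : arrow Q) : seq (qidx u) :=
  if source a =P u is ReflectT e
  then [:: ecast y (qidx y) e (Ia (qnil (source a)))] else [::].

Definition idx_cons (u : vertex Q) (a : arrow Q) (x : qidx (target a)) : seq (qidx u) :=
  if source a =P u is ReflectT e
  then [:: ecast y (qidx y) e
    match x with Iv v p => Iv (qcons p) | Ia b p => Ia (qcons p) end] else [::].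

(** The bound n concerns the length of the path only; the arrow recorded by [Ia] is not counted. *)
Fixpoint enum_qidx n (u : vertex Q) : seq (qidx u) :=
  Iv (qnil u) :: flatten [seq idx_nil u a | a <- enum (arrow Q)] ++
  match n with
  | 0%N => [::]
  | n.+1 => flatten [seq flatten [seq idx_cons u x | x <- enum_qidx n (target a)]
                    | a <- enum (arrow Q)]
  end.

Lemma mem_enum_qidx_cons n a (x : qidx (target a)) : x \in enum_qidx n (target a) ->
  match x with Iv v p => Iv (qcons p) | Ia b p => Ia (qcons p) end
    \in enum_qidx n.+1 (source a).
Proof.
move=> xs; rewrite /= inE mem_cat; apply/orP; right; apply/orP; right.
apply/flatten_mapP; exists a; first by rewrite mem_enum.
apply/flatten_mapP; exists x => //; rewrite /idx_cons; case: eqP => // e.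
by rewrite (eq_irrelevance e erefl) /= inE.
Qed.

Lemma mem_enum_qidx_nil n a : Ia (qnil (source a)) \in enum_qidx n (source a).
Proof.
case: n => [|n]; rewrite /= inE mem_cat; apply/orP; right; apply/orP; left;
  (apply/flatten_mapP; exists a; first by rewrite mem_enum);
  by rewrite /idx_nil; case: eqP => // e; rewrite (eq_irrelevance e erefl) /= inE.
Qed.

Lemma enum_qidxV n u v (p : qpath u v) : (qlen p <= n)%N -> Iv p \in enum_qidx n u.
Proof.
elim: p n => [w|a w p IH] [|n] //=; try by rewrite inE eqxx.
by move=> pn; apply: (@mem_enum_qidx_cons n a (Iv p)); apply: IH.
Qed.

(** The end of p is a variable tied to [source a] by an equation, so that induction on p is
    possible. *)
Lemma enum_qidxA n u w (p : qpath u w) a (e : w = source a) : (qlen p <= n)%N ->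
  Ia (ecast y (qpath u y) e p) \in enum_qidx n u.
Proof.
elim: p n e => [v n e _|b v p IH n e pn].
  by subst v; apply: mem_enum_qidx_nil.
case: n pn => // n pn; subst v.
by apply: (@mem_enum_qidx_cons n b (Ia p)); apply: (IH n erefl).
Qed.

Lemma dynkin_paths : is_dynkin Q ->
  exists s : forall u : vertex Q, seq (qidx u), forall u x, x \in s u.
Proof.
move=> /dynkin_height [h hP].
(* The length of a path is a difference of two heights, hence at most twice the largest absolute
   value. *)
pose N := (\max_v `|h v|%N).*2.
have lenN u v (p : qpath u v) : (qlen p <= N)%N.
  have := qlen_height p hP.
  have := @leq_bigmax _ (fun v => `|h v|%N) u; have := @leq_bigmax _ (fun v => `|h v|%N) v.
  by rewrite /= -/(N./2) /N; lia.
exists (enum_qidx N) => u [v p|a p]; first exact: enum_qidxV.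
exact: (@enum_qidxA N u _ p a erefl).
Qed.

End DynkinPaths.

(** * Brackets, Serre duality and the Euler characteristic *)

Lemma hom_dim_hdim (k : fieldType) (Q : quiver) (hQ : is_dynkin Q) (X N : Db k Q) b i :
  (forall i v, (b < `|i|)%N -> vdim X i v = 0%N) -> hom_dim X N i = hdim X N b i.
Proof.
move=> bP; have [s sP] := dynkin_paths hQ.
exact/dimkE/(fdim_hom bP sP (shiftR_iso X N i)).
Qed.

(** Hom(N, tau X [j]) has the dimension of Hom(N[-j], nu (X[-1])), which is dual to Hom(X[-1],
    N[-j]); the latter is the cohomology of the Hom complex of X and N in degree 1 - j. *)
Lemma hom_dim_tau (k : fieldType) (Q : quiver) (hQ : is_dynkin Q)
    (nu : functor (Db k Q) (Db k Q)) (hnu : is_serre_functor nu) (X N : Db k Q) j :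
  hom_dim N (tau nu X) j = hom_dim X N (1 - j).
Proof.
have [s sP] := dynkin_paths hQ.
have [b bP] := vdim_bounded X; have [b' bP'] := vdim_bounded N.
rewrite (hom_dim_hdim hQ _ _ bP) (hom_dim_hdim hQ _ _ bP').
have := fdim_hom bP sP (shift_iso_comp (shiftR_iso X N (- j)) (shiftL_iso _ _ (-1))).
rewrite opprK addrC => /(serre_fdim hnu).
have := fdim_hom bP' sP (shiftL_iso N (tau nu X) (- j)); rewrite opprK.
exact: fdim_uniq.
Qed.

Lemma bracket_euler (k : fieldType) (Q : quiver) (hQ : is_dynkin Q)
    (nu : functor (Db k Q) (Db k Q)) (hnu : is_serre_functor nu) (X N : Db k Q) b :
  (forall i v, (b < `|i|)%N -> vdim X i v = 0%N) ->
  bracket X N - bracket N (tau nu X) = zsum (fun n => (-1) ^ n * (hdim X N b n)%:Z).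
Proof.
move=> bP; have [L LP] := coch_dim_bounded X b N.
have h0 n : (L < `|n|)%N -> hdim X N b n = 0%N.
  by move=> /LP e0; apply/eqP; rewrite -leqn0 -[X in (_ <= X)%N]e0 /hdim -subnDA leq_subr.
pose F n := (-1) ^ n * (hdim X N b n)%:Z.
pose G n := if 0 < n then - F n else 0.
rewrite /bracket !sum_nonpos.
(* The reflection j -> 1 - j sends j <= 0 to positive degrees and reverses parity, hence the minus
   sign in G. *)
rewrite [X in _ - X](@zsum_ext _ (fun j => G (1 - j))); last first.
  move=> j; rewrite /G; have -> : (0 < 1 - j) = (j <= 0) by lia.
  case: ifP => // _; rewrite (hom_dim_tau hQ hnu) (hom_dim_hdim hQ _ _ bP) /F.
  by rewrite signzD signzN expr1z mulN1r mulNr opprK.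
rewrite (zsum_opp 1 G); apply/eqP; rewrite subr_eq -(@zsumD L); last 2 first.
- by move=> n nL; rewrite h0 ?mulr0.
- by move=> n nL; rewrite /G /F h0 // mulr0 oppr0 if_same.
apply/eqP/zsum_ext => n; rewrite (hom_dim_hdim hQ _ _ bP) /G ltNge -/(F n).
by case: ifP => _ /=; rewrite ?addr0 ?subrr.
Qed.

Theorem lemma2p9 (k : closedFieldType) (Q : quiver) (hQ : is_dynkin Q)
    (nu : functor (Db k Q) (Db k Q)) (hnu : is_serre_functor nu)
    (X M N : Db k Q) (hMN : dimvec M = dimvec N) :
  bracket X N - bracket X M = bracket N (tau nu X) - bracket M (tau nu X).
Proof.
have [b bP] := vdim_bounded X.
(* The same bound b on X serves for N and M, so the two Euler sums can be compared. *)
have EN := bracket_euler hQ hnu N bP; have EM := bracket_euler hQ hnu M bP.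
have := euler_dimvec bP hMN; rewrite -EN -EM => e; lia.
Qed.
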